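(* Let $u:\mathbb{R}^2\times[0,1]\to\mathbb{R}^3$ be a smooth, bounded vector field which, together with a smooth scalar pressure $p$, solves the problem $$ \begin{cases} (u\cdot\nabla)u+\nabla p-\Delta u=0 & \text{in } \mathbb{R}^2\times[0,1],\\ \nabla\cdot u=0 & \text{in } \mathbb{R}^2\times[0,1],\\ u(x)|_{x_3=0}=u(x)|_{x_3=1}=0, \end{cases} $$ and whose Dirichlet integral is finite: $$\int_0^1\int_{\mathbb{R}^2}|\nabla u(x)|^2\,dx<\infty .$$ Then $u\equiv 0$.
   Context: Points of $\mathbb{R}^2\times[0,1]$ are written $x=(x_1,x_2,x_3)$ with $(x_1,x_2)\in\mathbb{R}^2$ and $x_3\in[0,1]$. No assumption on the behaviour of the pressure $p$ at infinity is made. *)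

(* Defs.v *)
From HB Require Import structures.
From mathcomp Require Import all_boot all_order all_algebra.
From mathcomp Require Import all_classical all_reals all_analysis.
Set Implicit Arguments.
Unset Strict Implicit.
Unset Printing Implicit Defensive.
Import Order.TTheory GRing.Theory Num.Theory.
Import numFieldNormedType.Exports.
Local Open Scope classical_set_scope.
Local Open Scope ring_scope.

(* Fields on the closed slab R^2 x [0,1] are represented by total functions on
   'rV[R]_3, but on the slab every notion below depends only on their values there. *)

(* The coordinates x_1, x_2, x_3 are x 0 0, x 0 1 and x 0 ord_max. *)
Definition slab (R : realType) : set 'rV[R]_3 :=
  [set x | 0 <= x 0 ord_max <= 1].

Definition slab_point (R : realType) (y : R * R) (t : R) : 'rV[R]_3 :=
  \row_(i < 3) [:: y.1; y.2; t]`_i.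

Definition component (R : realType) (u : 'rV[R]_3 -> 'rV[R]_3) (i : 'I_3) :
  'rV[R]_3 -> R := fun x => u x 0 i.

Definition diff_quotient (R : realType) (j : 'I_3) (f : 'rV[R]_3 -> R)
    (x : 'rV[R]_3) (h : R) : R :=
  h^-1 * (f (h *: delta_mx 0 j + x) - f x).

(* The increments h of the j-th variable tend to 0 subject to x + h e_j staying
   in the slab: at an interior point, or for a horizontal direction, this is the
   usual punctured neighbourhood of 0; for j = 3 at the two boundary planes it
   gives the one-sided derivative. *)
Definition increments (R : realType) (j : 'I_3) (x : 'rV[R]_3) : set_system R :=
  within [set h : R | slab (h *: delta_mx 0 j + x)] (0 : R)^'.

Definition has_partial (R : realType) (j : 'I_3) (f : 'rV[R]_3 -> R)
    (x : 'rV[R]_3) : Prop :=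
  cvg (diff_quotient j f x @ increments j x).

Definition partial (R : realType) (j : 'I_3) (f : 'rV[R]_3 -> R)
    (x : 'rV[R]_3) : R :=
  lim (diff_quotient j f x @ increments j x).

Definition partials (R : realType) (s : seq 'I_3) (f : 'rV[R]_3 -> R) :
  'rV[R]_3 -> R := foldr (@partial R) f s.

(* C^infinity up to the boundary: all iterated partial derivatives exist at all
   points of the closed slab and are continuous on it. *)
Definition smooth (R : realType) (f : 'rV[R]_3 -> R) : Prop :=
  forall s : seq 'I_3,
    {within @slab R, continuous (partials s f)} /\
    (forall (j : 'I_3) (x : 'rV[R]_3), slab x -> has_partial j (partials s f) x).

Definition smooth_field (R : realType) (u : 'rV[R]_3 -> 'rV[R]_3) : Prop :=
  forall i : 'I_3, smooth (component u i).

Definition gradient (R : realType) (p : 'rV[R]_3 -> R) (x : 'rV[R]_3) :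
  'rV[R]_3 := \row_j partial j p x.

Definition divergence (R : realType) (u : 'rV[R]_3 -> 'rV[R]_3)
    (x : 'rV[R]_3) : R := \sum_(j < 3) partial j (component u j) x.

Definition laplacian (R : realType) (u : 'rV[R]_3 -> 'rV[R]_3)
    (x : 'rV[R]_3) : 'rV[R]_3 :=
  \row_i \sum_(j < 3) partial j (partial j (component u i)) x.

(* (u . nabla) u *)
Definition convection (R : realType) (u : 'rV[R]_3 -> 'rV[R]_3)
    (x : 'rV[R]_3) : 'rV[R]_3 :=
  \row_i \sum_(j < 3) u x 0 j * partial j (component u i) x.

(* |nabla u|^2 *)
Definition sqnorm_grad (R : realType) (u : 'rV[R]_3 -> 'rV[R]_3)
    (x : 'rV[R]_3) : R :=
  \sum_(i < 3) \sum_(j < 3) partial j (component u i) x ^+ 2.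

Definition dirichlet_integral (R : realType) (u : 'rV[R]_3 -> 'rV[R]_3) :
    \bar R :=
  (\int[lebesgue_measure]_(t in `[0%R, 1%R])
     \int[lebesgue_measure \x lebesgue_measure]_y
       (sqnorm_grad u (slab_point y t))%:E)%E.

(* On the slab the limit defining [partial] is never taken along a trivial
   filter. *)
Lemma increments_proper (R : realType) (j : 'I_3) (x : 'rV[R]_3) :
  slab x -> ProperFilter (increments j x).
Proof.
move=> /andP[x0 x1]; apply: Build_ProperFilter_ex => P.
rewrite /increments /within /= /dnbhs /within /= => /nbhs_ballP[e /= e0 be].
pose d := Num.min (e / 2) (2^-1 : R).
have d0 : 0 < d by rewrite lt_min divr_gt0 //= invr_gt0.
have de : d < e by rewrite gt_min ltr_pdivrMr // mulr_natr mulr2n ltrDl e0.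
have dh : d <= 2^-1 by rewrite ge_min lexx orbT.
pose h := if x 0 ord_max <= 2^-1 then d else - d.
have nh : `|h| = d by rewrite /h; case: ifP; rewrite ?normrN gtr0_norm.
exists h; apply: be => //.
- by rewrite -ball_normE /= sub0r normrN nh.
- by rewrite -normr_eq0 nh gt_eqF.
rewrite /slab /= !mxE eqxx /=.
have [_|_] := eqVneq j ord_max; last by rewrite mulr0 add0r x0.
rewrite mulr1 /h; case: ifPn => [xh|]; last rewrite -ltNge => xh.
  rewrite addr_ge0 ?(ltW d0)//=.
  by rewrite (le_trans (lerD dh xh))// [leRHS](splitr 1) mul1r.
rewrite addrC subr_ge0 (le_trans dh (ltW xh)) /=.
by rewrite lerBlDr (le_trans x1)// lerDl ltW.
Qed.

Lemma increments_interior (R : realType) (j : 'I_3) (x : 'rV[R]_3) :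
  0 < x 0 ord_max < 1 -> increments j x = (0 : R)^'.
Proof.
move=> /andP[x0 x1]; apply/seteqP; split => P; last exact: cvg_within.
rewrite /increments /within /= /dnbhs /within /= => /nbhs_ballP[e /= e0 be].
pose d := Num.min e (Num.min (x 0 ord_max) (1 - x 0 ord_max)).
have d0 : 0 < d by rewrite !lt_min e0 x0 subr_gt0.
apply/nbhs_ballP; exists d => //= h; rewrite -ball_normE /= sub0r normrN.
rewrite !lt_min => /and3P[he]; rewrite !ltr_norml => /andP[a1 a2] /andP[b1 b2] h0.
apply: be => //; first by rewrite -ball_normE /= sub0r normrN.
rewrite /slab /= !mxE eqxx /=.
have [_|_] := eqVneq j ord_max; last by rewrite mulr0 add0r !ltW.
rewrite mulr1; apply/andP; split.
  by rewrite -lerBlDr sub0r ltW.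
by rewrite -lerBrDr ltW.
Qed.

(* Inside the slab [has_partial] and [partial] are the library's directional
   derivability and derivative. *)
Lemma has_partial_interior (R : realType) (j : 'I_3) (f : 'rV[R]_3 -> R)
    (x : 'rV[R]_3) :
  0 < x 0 ord_max < 1 -> has_partial j f x <-> derivable f x (delta_mx 0 j).
Proof. by rewrite /has_partial => /increments_interior ->. Qed.

Lemma partial_interior (R : realType) (j : 'I_3) (f : 'rV[R]_3 -> R)
    (x : 'rV[R]_3) :
  0 < x 0 ord_max < 1 -> partial j f x = 'D_(delta_mx 0 j) f x.
Proof. by rewrite /partial => /increments_interior ->. Qed.

(* Main.v *)
Require Import Defs.
From HB Require Import structures.
From mathcomp Require Import all_boot all_order all_algebra.
From mathcomp Require Import all_classical all_reals all_analysis.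
From mathcomp Require Import measurable_realfun.
From mathcomp Require Import ring lra.
Import Order.TTheory GRing.Theory Num.Theory.
Import numFieldNormedType.Exports.
Local Open Scope classical_set_scope.
Local Open Scope ring_scope.
Set Implicit Arguments.
Unset Strict Implicit.
Unset Printing Implicit Defensive.

(** The no-slip condition and the finite Dirichlet integral put u in L^2 of the
slab, by the Poincaré inequality in the bounded direction, so the natural attempt
is to test the momentum equation with phi u, where phi is a horizontal cutoff at
scale L.  The obstacle is the pressure, about which nothing is known at infinity.
It disappears if the test field w = phi u + z is divergence-free and vanishes on
the boundary of the box [-L,L]^2 x [0,1], since then the pressure term integrates
to zero ([energy_identity]).

Such a corrector z is explicit.  The field
(int_0^{x_3} u_2, - int_0^{x_3} u_1, 0) has curl u; it vanishes on x_3 = 0, and on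
x_3 = 1 it is the horizontal gradient of the stream function psi of the
vertically averaged flow, which is divergence-free in the plane because u_3
vanishes on both planes.  Subtracting the gradient of H(x_3) psi, where H climbs
from 0 to 1 and H' vanishes at both ends, gives a potential A with curl A = u and
A = 0 on both planes ([potential]).  Then w = curl (phi A), that is,
z = grad phi x A ([corrector]).

The test yields int phi |grad u|^2 as a sum of terms that all contain a
derivative of phi, hence a factor 1/L.  Those where psi is not differentiated
need care, as psi is only O(L) in L^2 (choosing the additive constant of psi
well, [stream_function]), which cancels the gain of one derivative of phi.
There the polynomial cutoff helps: |grad phi|^2 is at most
C L^-2 (x_1^2 + x_2^2)/L^2, and (x_1^2 + x_2^2)/L^2 <= 2 (1 - phi).  By Young's
inequality, with E(L) the energy of the box, F(L) the energy weighted by phi and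
d > 0 arbitrary,
  F <= K (1/L + d) E + (K/d) (E - F),
where K depends on the bound for u only ([energy_estimate]).  Since the Dirichlet
integral converges, E - F tends to 0 as L grows; letting then d tend to 0 shows
that the Dirichlet integral vanishes ([boxint_energy_eq0]), and so does u.

All functions integrated are continuous, so integrals over a box are iterated
one-dimensional oriented integrals, for which exchanging the order of integration
and differentiating under the integral sign both follow from the fundamental
theorem of calculus.  Lebesgue integrals enter only through the existence of
primitives and the comparison of E(L) with the Dirichlet integral. *)

(** * Continuity of expressions *)

Lemma contC (T U : topologicalType) (k : U) : continuous (fun _ : T => k).
Proof. exact: cst_continuous. Qed.

Section Continuity.
Context {R : realType} {T : topologicalType}.
Implicit Types f g : T -> R.

Lemma contD f g : continuous f -> continuous g -> continuous (fun x => f x + g x).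
Proof. by move=> cf cg x; apply: continuousD; [exact: cf|exact: cg]. Qed.

Lemma contN f : continuous f -> continuous (fun x => - f x).
Proof. by move=> cf x; apply: continuousN; exact: cf. Qed.

Lemma contM f g : continuous f -> continuous g -> continuous (fun x => f x * g x).
Proof. by move=> cf cg x; apply: continuousM; [exact: cf|exact: cg]. Qed.

Lemma contX f n : continuous f -> continuous (fun x => f x ^+ n).
Proof.
move=> cf; elim: n => [|n IH]; first exact: contC.
rewrite (_ : (fun x => _) = fun x => f x * f x ^+ n); first exact: contM.
by apply/funext => x; rewrite exprS.
Qed.

Lemma cont_sum (I : Type) (s : seq I) (F : I -> T -> R) :
  (forall i, continuous (F i)) -> continuous (fun x => \sum_(i <- s) F i x).
Proof.
move=> cF; elim: s => [|i s IH].
  by under eq_fun do rewrite big_nil; exact: contC.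
by under eq_fun do rewrite big_cons; exact: contD.
Qed.

End Continuity.

Lemma contI (T : topologicalType) : continuous (fun x : T => x).
Proof. by move=> x; exact: cvg_id. Qed.

Lemma cont_pair (T U V : topologicalType) (f : T -> U) (g : T -> V) :
  continuous f -> continuous g -> continuous (fun x => (f x, g x)).
Proof. by move=> cf cg x; apply: cvg_pair; [exact: cf|exact: cg]. Qed.

Lemma cont_fst (T U V : topologicalType) (f : T -> U * V) :
  continuous f -> continuous (fun x => (f x).1).
Proof. by move=> cf x; apply: (continuous_comp (cf x)); exact: cvg_fst. Qed.

Lemma cont_snd (T U V : topologicalType) (f : T -> U * V) :
  continuous f -> continuous (fun x => (f x).2).
Proof. by move=> cf x; apply: (continuous_comp (cf x)); exact: cvg_snd. Qed.

Lemma contfst (U V : topologicalType) : continuous (@fst U V).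
Proof. by move=> x; exact: cvg_fst. Qed.

Lemma contsnd (U V : topologicalType) : continuous (@snd U V).
Proof. by move=> x; exact: cvg_snd. Qed.

Lemma cont_comp (T U V : topologicalType) (f : U -> V) (g : T -> U) :
  continuous f -> continuous g -> continuous (fun x => f (g x)).
Proof. by move=> cf cg x; apply: (continuous_comp (cg x)); exact: cf. Qed.

Lemma cont_comp2 (T U V W : topologicalType) (f : U -> V -> W) (a : T -> U) (b : T -> V) :
  continuous (fun z : U * V => f z.1 z.2) -> continuous a -> continuous b ->
  continuous (fun w => f (a w) (b w)).
Proof. by move=> cf ca cb; exact: (cont_comp cf (cont_pair ca cb)). Qed.

(** Directed by the syntax, because unification with the combinators would unfold
numerals and powers. *)
Ltac cont :=
  first [assumption | lazymatch goal with
  | |- continuous (fun x => x) => exact: contI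
  | |- continuous (fun _ => ?k) => exact: contC
  | |- continuous fst => exact: contfst
  | |- continuous snd => exact: contsnd
  | |- continuous (fun x => @?f x + @?g x) =>
      refine (contD (f := f) (g := g) _ _); cbv beta; cont
  | |- continuous (fun x => @?f x * @?g x) =>
      refine (contM (f := f) (g := g) _ _); cbv beta; cont
  | |- continuous (fun x => - @?f x) =>
      refine (contN (f := f) _); cbv beta; cont
  | |- continuous (fun x => @?f x ^+ ?n) =>
      refine (@contX _ _ f n _); cbv beta; cont
  | |- continuous (fun x => (@?f x, @?g x)) =>
      refine (cont_pair (f := f) (g := g) _ _); cbv beta; cont
  | |- continuous (fun x => (@?f x).1) =>
      refine (cont_fst (f := f) _); cbv beta; cont
  | |- continuous (fun x => (@?f x).2) =>
      refine (cont_snd (f := f) _); cbv beta; cont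
  | _ => idtac
  end].

(** * Oriented integral of a continuous function on the line *)

(** Taking increments of a primitive, instead of a Lebesgue integral over an
interval, makes Chasles' relation and dependence on the end points immediate,
whatever their order. *)
Definition primitive {R : realType} (f : R -> R) : R -> R :=
  xget (cst 0) [set F : R -> R | forall x : R, is_derive x (1 : R) F (f x)].

(** Locked, so that unification never turns an integral into a difference. *)
HB.lock Definition oint {R : realType} (a b : R) (f : R -> R) : R :=
  primitive f b - primitive f a.

Lemma ointE {R : realType} (a b : R) f : oint a b f = primitive f b - primitive f a.
Proof. by rewrite oint.unlock. Qed.

Section OrientedIntegral.
Context {R : realType}.
Implicit Types (f g F G : R -> R) (a b c d x y : R).

Lemma locally_primitive f (N : R) : continuous f ->
  forall x, N < x ->
    is_derive x 1 (fun x => \int[lebesgue_measure]_(t in `[N, x]) f t)%R (f x).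
Proof.
move=> cf x Nx.
have [] := @continuous_FTC1_closed R f N x (x + 1) _ _ Nx (cf x).
- by rewrite ltrDl.
- apply: continuous_compact_integrable; first exact: segment_compact.
  exact: continuous_subspaceT.
- by move=> dF <-; rewrite derive1E; apply: DeriveDef.
Qed.

(** The integral from N is a primitive only on the right of N; subtracting its value
at 0 makes it independent of N, so the local primitives glue on the whole line. *)
Lemma has_primitive f : continuous f ->
  exists F : R -> R, forall x, is_derive x 1 F (f x).
Proof.
move=> cf.
pose S (N x : R) := (\int[lebesgue_measure]_(t in `[N, x]) f t)%R.
have intf N x : lebesgue_measure.-integrable `[N, x] (EFin \o f).
  apply: continuous_compact_integrable; first exact: segment_compact.
  exact: continuous_subspaceT.
have SB (N N' x : R) : N' <= N -> N < x -> N < 0 -> S N x - S N 0 = S N' x - S N' 0.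
  move=> NN Nx N0.
  have H y : N < y -> S N' y - S N' N = S N y.
    move=> Ny; rewrite /S Rintegral_itvB ?bnd_simp ?(ltW Ny) //.
    rewrite Rintegral_itv_obnd_cbnd //.
    by apply: integrableS (intf N y) => //; apply: subset_itvr; rewrite bnd_simp.
  by rewrite -(H x) // -(H 0) //; ring.
pose F x := S (- (`|x| + 1)) x - S (- (`|x| + 1)) 0.
exists F => x.
have := @locally_primitive f (- (`|x| + 2)) cf x.
have Nx : - (`|x| + 2) < x by have := ler_norm (- x); rewrite normrN; lra.
move=> /(_ Nx) d.
have {}d : is_derive x 1 (fun y => S (- (`|x| + 2)) y - S (- (`|x| + 2)) 0) (f x).
  have := @is_deriveB _ _ _ _ (cst (S (- (`|x| + 2)) 0)) _ _ _ _ d (is_derive_cst _ _ _).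
  by rewrite subr0.
apply: near_eq_is_derive d.
near=> y.
rewrite /F; apply/esym/SB.
- have : `|y - x| < 1.
    by near: y; apply/nbhs_ballP; exists 1 => //= y; rewrite -ball_normE /= distrC.
  have := ler_normD x (y - x); rewrite addrCA subrr addr0; lra.
- have := ler_norm (- y); rewrite normrN; lra.
- have := normr_ge0 y; lra.
Unshelve. all: by end_near.
Qed.

Lemma is_derive_primitive f x : continuous f -> is_derive x 1 (primitive f) (f x).
Proof.
move=> /has_primitive[F HF]; rewrite /primitive.
by case: xgetP => [G _ HG|/(_ F)//]; exact: HG.
Qed.

Lemma is_derive_continuous f (df : R -> R) :
  (forall x, is_derive x 1 f (df x)) -> continuous f.
Proof.
by move=> H x; apply/differentiable_continuous/derivable1_diffP; case: (H x).
Qed.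

Lemma continuous_primitive f : continuous f -> continuous (primitive f).
Proof. by move=> cf; apply: is_derive_continuous (fun x => is_derive_primitive x cf). Qed.

Lemma is_derive_oint f a b : continuous f -> is_derive b (1 : R) (oint a ^~ f) (f b).
Proof.
move=> cf; have := is_deriveB (is_derive_primitive b cf) (is_derive_cst (primitive f a) b 1).
rewrite subr0 (_ : _ - _ = oint a ^~ f) //.
by apply/funext => x; rewrite ointE !fctE.
Qed.

Lemma oint_FTC_oo f G a b : continuous f -> a <= b ->
  {within `[a, b], continuous G} ->
  (forall x, a < x < b -> is_derive x 1 G (f x)) ->
  oint a b f = G b - G a.
Proof.
move=> cf ab cG dG.
have dH x : x \in `]a, b[%R -> is_derive x 1 (primitive f - G) (cst 0 x).
  rewrite in_itv /= => xab.
  by have := is_deriveB (is_derive_primitive x cf) (dG _ xab); rewrite subrr.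
have [] := MVT_segment ab dH.
  move=> x; apply: continuousB; last exact: cG.
  exact/continuous_subspaceT/continuous_primitive.
by move=> c _; rewrite /cst mul0r !ointE !fctE; lra.
Qed.

Lemma oint_swap f a b : oint a b f = - oint b a f.
Proof. by rewrite !ointE opprB. Qed.

Lemma oint_chasles f a b c : oint a b f + oint b c f = oint a c f.
Proof. by rewrite !ointE; lra. Qed.

Lemma oint_aa f a : oint a a f = 0.
Proof. by rewrite !ointE subrr. Qed.

Lemma oint_FTC f G a b : continuous f ->
  (forall x, is_derive x 1 G (f x)) -> oint a b f = G b - G a.
Proof.
move=> cf dG; have cG := is_derive_continuous dG.
wlog ab : a b / a <= b.
  move=> H; case: (leP a b) => [/H//|/ltW/H]; rewrite oint_swap; lra.
by apply: oint_FTC_oo => //; exact: continuous_subspaceT.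
Qed.

Lemma ointD f g a b : continuous f -> continuous g ->
  oint a b (fun x => f x + g x) = oint a b f + oint a b g.
Proof.
move=> cf cg; have cfg : continuous (fun x => f x + g x).
  exact: contD.
have dG x : is_derive x 1 (primitive f + primitive g) (f x + g x).
  by apply: is_deriveD; exact: is_derive_primitive.
by rewrite (oint_FTC a b cfg dG) !ointE !fctE; lra.
Qed.

Lemma ointZ k f a b : continuous f ->
  oint a b (fun x => k * f x) = k * oint a b f.
Proof.
move=> cf; have ckf : continuous (fun x => k * f x).
  by cont.
have dG x : is_derive x 1 (k *: primitive f) (k * f x).
  by apply: is_deriveZ; exact: is_derive_primitive.
by rewrite (oint_FTC a b ckf dG) !ointE mulrBr.
Qed.

Lemma ointB f g a b : continuous f -> continuous g ->
  oint a b (fun x => f x - g x) = oint a b f - oint a b g.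
Proof.
move=> cf cg; rewrite -mulN1r -ointZ // -ointD //.
  by congr oint; apply/funext => x; rewrite mulN1r.
by cont.
Qed.

Lemma oint_cst k a b : oint a b (fun _ => k) = k * (b - a).
Proof.
have dG x : is_derive x 1 (k *: (id : R -> R)) (cst k x).
  by have := is_deriveZ k (is_derive_id x (1 : R)); rewrite [_ *: _]mulr1.
by rewrite (oint_FTC a b (@cst_continuous _ _ k) dG) mulrBr.
Qed.

Lemma oint_MVT f a b : continuous f -> a <= b ->
  exists2 c, a <= c <= b & oint a b f = f c * (b - a).
Proof.
move=> cf ab; have [] := @MVT_segment R (primitive f) f a b ab.
- by move=> x _; exact: is_derive_primitive.
- exact/continuous_subspaceT/continuous_primitive.
- by move=> c; rewrite in_itv -ointE; exists c.
Qed.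

Lemma oint_ge0 f a b : continuous f -> a <= b ->
  (forall x, a <= x <= b -> 0 <= f x) -> 0 <= oint a b f.
Proof.
move=> cf ab f0; have [c abc ->] := oint_MVT cf ab.
by rewrite mulr_ge0 ?f0 // subr_ge0.
Qed.

Lemma le_oint f g a b : continuous f -> continuous g -> a <= b ->
  (forall x, a <= x <= b -> f x <= g x) -> oint a b f <= oint a b g.
Proof.
move=> cf cg ab fg; rewrite -subr_ge0 -ointB //; apply: oint_ge0 => //.
  by cont.
by move=> x /fg; rewrite subr_ge0.
Qed.

Lemma eq_oint f g a b : continuous f -> continuous g -> a <= b ->
  (forall x, a <= x <= b -> f x = g x) -> oint a b f = oint a b g.
Proof.
by move=> cf cg ab fg; apply/eqP; rewrite eq_le !le_oint // => x /fg ->.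
Qed.

Lemma le_oint_itv f a b c d : continuous f -> a <= c -> c <= d -> d <= b ->
  (forall x, 0 <= f x) -> oint c d f <= oint a b f.
Proof.
move=> cf ac cd db f0; rewrite -(oint_chasles f a c b) -(oint_chasles f c d b).
have := @oint_ge0 f a c cf ac (fun x _ => f0 x).
have := @oint_ge0 f d b cf db (fun x _ => f0 x); lra.
Qed.

Lemma oint_norm_le f a b (M : R) : continuous f ->
  (forall x, Num.min a b <= x <= Num.max a b -> `|f x| <= M) ->
  `|oint a b f| <= M * `|b - a|.
Proof.
move=> cf; wlog ab : a b / a <= b.
  move=> H fM; case/orP: (le_total a b) => [ab|ba]; first exact: H.
  rewrite oint_swap normrN [X in M * X]distrC; apply: (H b a ba) => x.
  by rewrite minC maxC; exact: fM.
rewrite min_l // max_r // => fM; have [c abc ->] := oint_MVT cf ab.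
by rewrite normrM ler_wpM2r // fM.
Qed.

(** Cauchy-Schwarz inequality, on a subinterval run through in either direction: the
integral of the square of f minus its mean is nonnegative. *)
Lemma sqr_oint_le f a b c d : continuous f ->
  a <= c <= b -> a <= d <= b ->
  oint c d f ^+ 2 <= (b - a) * oint a b (fun x => f x ^+ 2).
Proof.
move=> cf; wlog cd : c d / c <= d.
  move=> H; case: (leP c d) => [/H//|/ltW/H + hc hd].
  by rewrite oint_swap sqrrN; exact.
move=> /andP[ac cb] /andP[ad db].
have cf2 : continuous (fun x => f x ^+ 2).
  by cont.
apply: (@le_trans _ _ ((d - c) * oint c d (fun x => f x ^+ 2))); last first.
  apply: ler_pM; [lra| |lra|]; first by apply: oint_ge0 => // x _; exact: sqr_ge0.
  by apply: le_oint_itv => // x; exact: sqr_ge0.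
move: cd; rewrite le_eqVlt => /predU1P[->|cd]; first by rewrite !oint_aa expr0n /= mulr0.
have dc0 : 0 < d - c by rewrite subr_gt0.
have [m mE] : exists m, oint c d f = m * (d - c).
  by exists (oint c d f / (d - c)); rewrite divfK // gt_eqF.
have cmf : continuous (fun x => - 2 * m * f x) by cont.
have : 0 <= oint c d (fun x => (f x ^+ 2 + - 2 * m * f x) + m ^+ 2).
  apply: oint_ge0; [by cont|exact: ltW|].
  by move=> x _; rewrite (_ : _ + _ = (f x - m) ^+ 2) ?sqr_ge0 //; ring.
rewrite ointD; [|by cont|by cont].
rewrite ointD // (ointZ _ _ _ cf).
rewrite oint_cst mE.
by move=> H; have := mulr_ge0 (ltW dc0) H; lra.
Qed.

(** If f did not vanish at x, it would not vanish on a nondegenerate subinterval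
around x, against the mean value theorem. *)
Lemma oint_eq0 f a b : continuous f -> a <= b ->
  (forall x, a <= x <= b -> 0 <= f x) -> oint a b f = 0 -> a < b ->
  forall x, a <= x <= b -> f x = 0.
Proof.
move=> cf ab f0 If altb x /andP[ax xb].
have If0 y : a <= y <= b -> oint a y f = 0.
  move=> /andP[ay yb]; apply/eqP; rewrite eq_le oint_ge0 // ?andbT; last first.
    by move=> z /andP[az zy]; rewrite f0 // az (le_trans zy).
  rewrite -If -(oint_chasles f a y b) lerDl oint_ge0 //.
  by move=> z /andP[yz zb]; rewrite f0 // zb andbT (le_trans ay).
apply/eqP/negP => /negP fx0.
have : \forall y \near x, f y != 0.
  by have := cf x; move=> /cvgr_neq0; exact.
move=> /nbhs_ballP[e /= e0 fe].
have [x1 [x2 [ax1 x12 x2b xe]]] : exists x1 x2, [/\ a <= x1, x1 < x2, x2 <= b &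
    forall c, x1 <= c <= x2 -> `|x - c| < e].
  case: (ltP x b) => [xltb|bx].
    exists x, (Num.min b (x + e / 2)); split => //.
    - by rewrite lt_min xltb ltrDl divr_gt0.
    - by rewrite ge_min lexx.
    - by move=> c /andP[xc]; rewrite le_min => /andP[_ cx]; rewrite ltr_distlC; lra.
  exists (Num.max a (x - e / 2)), x; split => //.
  - by rewrite le_max lexx.
  - by rewrite gt_max (lt_le_trans altb bx) gtrDl oppr_lt0 divr_gt0.
  - by move=> c /andP[]; rewrite ge_max => /andP[_ cx] xc; rewrite ltr_distlC; lra.
have [c cx] := oint_MVT cf (ltW x12).
have -> : oint x1 x2 f = 0.
  have := oint_chasles f a x1 x2; rewrite If0 ?If0 ?add0r //; lra.
move=> /esym/eqP; rewrite mulf_eq0 subr_eq0 (gt_eqF x12) orbF; apply/negP.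
by apply: fe; rewrite -ball_normE /=; exact: xe.
Qed.

Lemma oint_integral f a b : continuous f -> a < b ->
  (\int[lebesgue_measure]_(x in `[a, b]) (f x)%:E)%E = (oint a b f)%:E.
Proof.
move=> cf ab; rewrite ointE (@continuous_FTC2 _ _ (primitive f)) //.
- exact: continuous_subspaceT.
- split.
  + by move=> x _; case: (is_derive_primitive x cf).
  + exact/cvg_at_right_filter/continuous_primitive.
  + exact/cvg_at_left_filter/continuous_primitive.
- by move=> x _; rewrite derive1E; case: (is_derive_primitive x cf).
Qed.

Lemma is_derive_eps f x l :
  (forall e : R, 0 < e -> \forall y \near x, `|f y - f x - l * (y - x)| <= e * `|y - x|) ->
  is_derive x 1 f l.
Proof.
move=> H.
have : (fun h : R => h^-1 *: ((f \o shift x) (h *: (1 : R)) - f x)) @ 0^' --> l.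
  apply/cvgrPdist_le => e e0.
  have /nbhs_ballP[d /= d0 He] := H e e0.
  apply/nbhs_ballP; exists d => //= h; rewrite -ball_normE /= sub0r normrN => hd h0.
  rewrite [_ *: 1]mulr1 distrC.
  have := He (h + x); rewrite -ball_normE /= opprD addrCA subrr addr0 normrN.
  move=> /(_ hd); rewrite addrK => K.
  rewrite -(ler_pM2r (_ : 0 < `|h|)) ?normr_gt0 // -normrM.
  by rewrite mulrBl [_ *: _]mulrC mulfVK.
by move=> K; apply: DeriveDef; [apply/cvg_ex; exists l|exact: cvg_lim].
Qed.

End OrientedIntegral.

Section ParametricIntegral.
Context {R : realType}.

(** Tube lemma: continuity in the parameter is uniform over a compact segment. *)
Lemma near_unif_segment (T : topologicalType) (f : T -> R -> R) w (a b e : R) :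
  continuous (fun z : T * R => f z.1 z.2) -> 0 < e ->
  \forall w' \near w, forall s, a <= s <= b -> `|f w' s - f w s| < e.
Proof.
move=> cf e0.
have ncov := (proj1 (@compact_near_coveringP R `[a, b]%classic)) (@segment_compact _ _ _).
have H := ncov T (nbhs w) (fun w' s => `|f w' s - f w s| < e) (nbhs_filter w).
apply: filterS (H _) => [w' Hw' s abs|s abs].
  by apply: Hw'; rewrite /= in_itv.
have cg : continuous (fun z : R * T => f z.2 z.1 - f w z.1).
  by apply: contD; [|apply: contN]; apply: (cont_comp2 cf); cont.
have /= := cg (s, w); rewrite /continuous_at /= subrr => /cvgr0_norm_lt/(_ e e0).
exact.
Qed.

Lemma continuous_oint0 (T : topologicalType) (f : T -> R -> R) :
  continuous (fun z : T * R => f z.1 z.2) ->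
  continuous (fun z : T * R => oint 0 z.2 (f z.1)).
Proof.
move=> cf.
have cfw w : continuous (f w).
  by apply: (cont_comp2 cf); cont.
move=> [w c]; apply/cvgrPdist_lt => e e0 /=.
pose B := `|c| + 1.
have B0 : 0 < B by rewrite /B ltr_pwDr.
have e1 : 0 < e / 2 / B by rewrite !divr_gt0.
have A1 := near_unif_segment w (- B) B cf e1.
have A2 : \forall c' \near c, `|oint 0 c (f w) - oint 0 c' (f w)| < e / 2.
  have : continuous (oint 0 ^~ (f w)).
    exact: is_derive_continuous (fun x => is_derive_oint 0 x (cfw w)).
  by move=> /(_ c)/cvgrPdist_lt; apply; rewrite divr_gt0.
have A3 : \forall c' \near c, `|c' - c| < 1.
  by apply/nbhs_ballP; exists 1 => //= y; rewrite -ball_normE /= distrC.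
near=> z.
have z1 : forall s, - B <= s <= B -> `|f z.1 s - f w s| < e / 2 / B.
  by near: z; exact: (cvg_fst A1).
have z2 : `|oint 0 c (f w) - oint 0 z.2 (f w)| < e / 2.
  by near: z; exact: (cvg_snd A2).
have z3 : `|z.2 - c| < 1 by near: z; exact: (cvg_snd A3).
have zB : `|z.2| <= B.
  by have := ler_normD c (z.2 - c); rewrite addrCA subrr addr0 /B; lra.
have {}z1 : `|oint 0 z.2 (f w) - oint 0 z.2 (f z.1)| <= e / 2.
  rewrite -ointB //; apply: (@le_trans _ _ (e / 2 / B * `|z.2 - 0|)).
    apply: oint_norm_le; first by apply: contD => //; exact: contN.
    move=> s hs; rewrite distrC; apply/ltW/z1; move: zB hs.
    by rewrite ler_norml ge_min le_max; case: (lerP 0 z.2); lra.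
  rewrite subr0 -mulrA; apply: ler_piMr; first by rewrite divr_ge0 // ltW.
  by rewrite ler_pdivrMl // mulr1.
have := ler_normD (oint 0 c (f w) - oint 0 z.2 (f w))
  (oint 0 z.2 (f w) - oint 0 z.2 (f z.1)).
by rewrite addrA subrK; lra.
Unshelve. all: by end_near.
Qed.

Lemma cont_oint (T : topologicalType) (f : T -> R -> R) (a b : T -> R) :
  continuous (fun z : T * R => f z.1 z.2) -> continuous a -> continuous b ->
  continuous (fun w => oint (a w) (b w) (f w)).
Proof.
move=> cf ca cb; have c0 := continuous_oint0 cf.
have -> : (fun w => oint (a w) (b w) (f w)) = fun w => oint 0 (b w) (f w) - oint 0 (a w) (f w).
  by apply/funext => w; rewrite !ointE; lra.
apply: contD; last apply: contN.
- exact: (@cont_comp2 _ _ _ _ (fun w c => oint 0 c (f w)) id b c0 (@contI _) cb).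
- exact: (@cont_comp2 _ _ _ _ (fun w c => oint 0 c (f w)) id a c0 (@contI _) ca).
Qed.

(** Both [oint_exchange] and [is_derive_oint_param] come from this derivative: the
former as two functions of b with the same derivative agree up to a constant, the
latter by writing f x as f 0 plus the integral of its derivative. *)
Lemma is_derive_oint_oint (f : R -> R -> R) (a b c d : R) :
  continuous (fun z : R * R => f z.1 z.2) ->
  is_derive b 1 (fun b => oint c d (fun y => oint a b (f ^~ y))) (oint c d (f b)).
Proof.
move=> cf.
have c1 x : continuous (f x).
  by apply: (cont_comp2 cf); cont.
have c2 y : continuous (f ^~ y).
  by apply: (cont_comp2 cf); cont.
have c3 a' b' : continuous (fun y => oint a' b' (f ^~ y)).
  apply: cont_oint; [|exact: contC|exact: contC].
  by apply: (cont_comp2 cf); cont.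
apply: is_derive_eps => e e0.
have D0 : 0 < `|d - c| + 1 by rewrite ltr_wpDl.
have e1 : 0 < e / (`|d - c| + 1) by rewrite divr_gt0.
have := near_unif_segment b (Num.min c d) (Num.max c d) cf e1 => /nbhs_ballP[r /= r0 Hr].
apply/nbhs_ballP; exists r => //= b'; rewrite -ball_normE /= => bb'.
rewrite -ointB // (_ : (fun _ => _) = fun y => oint b b' (f ^~ y)); last first.
  by apply/funext => y; rewrite -(oint_chasles _ a b b') addrAC subrr add0r.
rewrite mulrC -ointZ // -ointB //; last by cont.
apply: (@le_trans _ _ (e / (`|d - c| + 1) * `|b' - b| * `|d - c|)).
  apply: oint_norm_le; first by apply: contD => //; cont.
  move=> y hy; rewrite mulrC -(oint_cst (f b y)) -ointB //; last exact: contC.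
  apply: oint_norm_le; first by apply: contD => //; cont.
  move=> x hx; apply/ltW/Hr => //; rewrite -ball_normE /=.
  move: hx bb'; rewrite !ltr_norml ge_min le_max.
  by case: (lerP b b'); lra.
rewrite -mulrA [X in _ * X]mulrC mulrA ler_wpM2r //.
rewrite -mulrA; apply: ler_piMr; first exact: ltW.
by rewrite ler_pdivrMl // mulr1 lerDl.
Qed.

(** Fubini's theorem. *)
Lemma oint_exchange (f : R -> R -> R) (a b c d : R) :
  continuous (fun z : R * R => f z.1 z.2) ->
  oint a b (fun x => oint c d (f x)) = oint c d (fun y => oint a b (f ^~ y)).
Proof.
move=> cf; have cfx : continuous (fun x => oint c d (f x)).
  by apply: cont_oint => //; exact: contC.
have d1 x := @is_derive_oint_oint f a x c d cf.
rewrite (oint_FTC a b cfx d1).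
rewrite [X in _ - X](_ : _ = 0) ?subr0 //.
rewrite (_ : (fun y => _) = fun=> 0); last by apply/funext => y; rewrite oint_aa.
by rewrite oint_cst mul0r.
Qed.

(** Differentiation under the integral sign. *)
Lemma is_derive_oint_param (f g : R -> R -> R) (c d x : R) :
  continuous (fun z : R * R => f z.1 z.2) ->
  continuous (fun z : R * R => g z.1 z.2) ->
  (forall x y : R, is_derive x 1 (f ^~ y) (g x y)) ->
  is_derive x 1 (fun x => oint c d (f x)) (oint c d (g x)).
Proof.
move=> cf cg fg.
have c1 : continuous (f 0).
  by apply: (cont_comp2 cf); cont.
have c2 y : continuous (g ^~ y).
  by apply: (cont_comp2 cg); cont.
have -> : (fun x => oint c d (f x)) =
    cst (oint c d (f 0)) + (fun x => oint c d (fun y => oint 0 x (g ^~ y))).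
  apply/funext => z; rewrite !fctE /cst -ointD //.
    congr oint; apply/funext => y.
    by rewrite (oint_FTC 0 z (c2 y) (fun x => fg x y)) addrC subrK.
  apply: cont_oint; [|exact: contC|exact: contC].
  by apply: (cont_comp2 cg); cont.
have := is_deriveD (is_derive_cst (oint c d (f 0)) x (1:R)) (@is_derive_oint_oint g 0 x c d cg).
by rewrite add0r.
Qed.

End ParametricIntegral.

(** * Fields on the slab and their integrals over boxes *)

Section Derivation.
Context {R : realType}.
Implicit Types (f g : R -> R) (x a b : R).

Lemma derC k x : is_derive x (1 : R) (fun _ : R => k : R) 0.
Proof. exact: is_derive_cst. Qed.

Lemma derD f g x a b : is_derive x 1 f a -> is_derive x 1 g b ->
  is_derive x 1 (fun x => f x + g x) (a + b).
Proof. exact: is_deriveD. Qed.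

Lemma derN f x a : is_derive x 1 f a -> is_derive x 1 (fun x => - f x) (- a).
Proof. exact: is_deriveN. Qed.

Lemma derM f g x a b : is_derive x 1 f a -> is_derive x 1 g b ->
  is_derive x 1 (fun x => f x * g x) (a * g x + f x * b).
Proof.
move=> fa gb; have := is_deriveM fa gb.
by rewrite /GRing.scale /= addrC [g x * a]mulrC.
Qed.

Lemma der_sum (I : Type) (s : seq I) (F : I -> R -> R) (dF : I -> R) x :
  (forall i, is_derive x 1 (F i) (dF i)) ->
  is_derive x 1 (fun x => \sum_(i <- s) F i x) (\sum_(i <- s) dF i).
Proof.
move=> H; elim: s => [|i s IH].
  by under eq_fun do rewrite big_nil; rewrite big_nil; exact: derC.
by under eq_fun do rewrite big_cons; rewrite big_cons; exact: derD.
Qed.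

End Derivation.

Definition o0 : 'I_3 := @Ordinal 3 0 isT.
Definition o1 : 'I_3 := @Ordinal 3 1 isT.
Definition o2 : 'I_3 := @Ordinal 3 2 isT.

Lemma sum3 (V : nmodType) (F : 'I_3 -> V) : \sum_(i < 3) F i = F o0 + F o1 + F o2.
Proof.
rewrite !big_ord_recl big_ord0 addr0 addrA.
by congr (F _ + F _ + F _); exact/val_inj.
Qed.

Lemma ord3_ind (P : 'I_3 -> Prop) : P o0 -> P o1 -> P o2 -> forall i, P i.
Proof.
move=> p0 p1 p2 [[|[|[|//]]] lt3]; rewrite (bool_irrelevance lt3 isT) //.
Qed.

Section Fields.
Context {R : realType}.
Implicit Types (f g : R -> R -> R -> R) (x y t L : R).

Definition cfield f := continuous (fun z : R * R * R => f z.1.1 z.1.2 z.2).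

Lemma cfield_comp (T : topologicalType) f (a b c : T -> R) : cfield f ->
  continuous a -> continuous b -> continuous c ->
  continuous (fun w => f (a w) (b w) (c w)).
Proof.
move=> cf ca cb cc.
exact: (@cont_comp _ _ _ (fun z : R * R * R => f z.1.1 z.1.2 z.2)
  (fun w => (a w, b w, c w)) cf (cont_pair (cont_pair ca cb) cc)).
Qed.

(** g is the j-th partial derivative of f.  Fields are extended by constants
beyond the two planes, so that vertical derivatives make sense inside the slab
only. *)
Definition pd (j : 'I_3) f g : Prop := match val j with
  | 0%N => forall x y t, is_derive x 1 (fun x => f x y t) (g x y t)
  | 1%N => forall x y t, is_derive y 1 (fun y => f x y t) (g x y t)
  | _ => forall x y t, 0 < t < 1 -> is_derive t 1 (fun t => f x y t) (g x y t)
  end.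

Lemma pdC j (k : R) : pd j (fun _ _ _ => k) (fun _ _ _ => 0).
Proof. by elim/ord3_ind: j; rewrite /pd /= => *; exact: derC. Qed.

Lemma pdD j f g f' g' : pd j f f' -> pd j g g' ->
  pd j (fun x y t => f x y t + g x y t) (fun x y t => f' x y t + g' x y t).
Proof. by elim/ord3_ind: j; rewrite /pd /= => hf hg *; apply: derD; [exact: hf|exact: hg]. Qed.

Lemma pdN j f f' : pd j f f' -> pd j (fun x y t => - f x y t) (fun x y t => - f' x y t).
Proof. by elim/ord3_ind: j; rewrite /pd /= => hf *; apply: derN; exact: hf. Qed.

Lemma pdM j f g f' g' : pd j f f' -> pd j g g' ->
  pd j (fun x y t => f x y t * g x y t)
       (fun x y t => f' x y t * g x y t + f x y t * g' x y t).
Proof.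
by elim/ord3_ind: j; rewrite /pd /= => hf hg *;
  [ apply: (derM (f := fun x => f x _ _) (g := fun x => g x _ _))
  | apply: (derM (f := fun y => f _ y _) (g := fun y => g _ y _))
  | apply: (derM (f := fun t => f _ _ t) (g := fun t => g _ _ t)) ];
  [exact: hf|exact: hg].
Qed.

Lemma pd_sum j (F F' : 'I_3 -> R -> R -> R -> R) : (forall i, pd j (F i) (F' i)) ->
  pd j (fun x y t => \sum_(i < 3) F i x y t) (fun x y t => \sum_(i < 3) F' i x y t).
Proof.
elim/ord3_ind: j; rewrite /pd /= => H *; apply: der_sum => i; exact: H.
Qed.

Lemma pd_ext j f g g' : pd j f g -> (forall x y t, g x y t = g' x y t) -> pd j f g'.
Proof.
by move=> fg gg'; elim/ord3_ind: j fg; rewrite /pd /= => fg x y t *; rewrite -gg'; exact: fg.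
Qed.

Definition boxint L f : R :=
  oint (- L) L (fun x => oint (- L) L (fun y => oint 0 1 (f x y))).

Section Continuity.
Context {f : R -> R -> R -> R} (cf : cfield f).

Lemma cfield_t x y : continuous (f x y).
Proof. by apply: (cfield_comp cf); cont. Qed.

Lemma cont_oint_t : continuous (fun z : R * R => oint 0 1 (f z.1 z.2)).
Proof.
apply: (@cont_oint R _ (fun z : R * R => f z.1 z.2) (fun=> 0) (fun=> 1)); cont.
Qed.

Lemma cont_oint_t_y x : continuous (fun y => oint 0 1 (f x y)).
Proof.
by apply: (cont_comp2 (f := fun x y => oint 0 1 (f x y)) cont_oint_t); cont.
Qed.

Lemma cont_oint_yt L : continuous (fun x => oint (- L) L (fun y => oint 0 1 (f x y))).
Proof.
apply: (@cont_oint R _ (fun x y => oint 0 1 (f x y)) (fun=> - L) (fun=> L)); cont.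
exact: cont_oint_t.
Qed.

End Continuity.

Lemma cfieldC (k : R) : cfield (fun _ _ _ => k).
Proof. exact: contC. Qed.
Lemma cfieldD f g : cfield f -> cfield g -> cfield (fun x y t => f x y t + g x y t).
Proof. exact: contD. Qed.
Lemma cfieldM f g : cfield f -> cfield g -> cfield (fun x y t => f x y t * g x y t).
Proof. exact: contM. Qed.
Lemma cfieldN f : cfield f -> cfield (fun x y t => - f x y t).
Proof. exact: contN. Qed.
Lemma cfieldX f n : cfield f -> cfield (fun x y t => f x y t ^+ n).
Proof. exact: contX. Qed.
Lemma cfield_sum (F : 'I_3 -> R -> R -> R -> R) : (forall i, cfield (F i)) ->
  cfield (fun x y t => \sum_(i < 3) F i x y t).
Proof. by move=> cF; apply: cont_sum. Qed.

Lemma le_boxint L f g : 0 <= L -> cfield f -> cfield g ->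
  (forall x y t, - L <= x <= L -> - L <= y <= L -> 0 <= t <= 1 -> f x y t <= g x y t) ->
  boxint L f <= boxint L g.
Proof.
move=> L0 cf cg fg; have LL : - L <= L by lra.
apply: le_oint => // [||x xL]; [exact: cont_oint_yt|exact: cont_oint_yt|].
apply: le_oint => // [||y yL]; [exact: cont_oint_t_y|exact: cont_oint_t_y|].
apply: le_oint => //; [exact: cfield_t|exact: cfield_t|].
by move=> t t01; exact: fg.
Qed.

Lemma boxint_ge0 L f : 0 <= L -> cfield f ->
  (forall x y t, - L <= x <= L -> - L <= y <= L -> 0 <= t <= 1 -> 0 <= f x y t) ->
  0 <= boxint L f.
Proof.
move=> L0 cf f0; have LL : - L <= L by lra.
apply: oint_ge0 => // [|x xL]; first exact: cont_oint_yt.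
apply: oint_ge0 => // [|y yL]; first exact: cont_oint_t_y.
by apply: oint_ge0 => // [|t t01]; [exact: cfield_t|exact: f0].
Qed.

Lemma eq_boxint L f g : 0 <= L -> cfield f -> cfield g ->
  (forall x y t, - L <= x <= L -> - L <= y <= L -> 0 <= t <= 1 -> f x y t = g x y t) ->
  boxint L f = boxint L g.
Proof.
by move=> L0 cf cg fg; apply/eqP; rewrite eq_le !le_boxint // => *; rewrite fg.
Qed.

Lemma boxintD L f g : cfield f -> cfield g ->
  boxint L (fun x y t => f x y t + g x y t) = boxint L f + boxint L g.
Proof.
move=> cf cg; rewrite /boxint -ointD; [|exact: cont_oint_yt..].
congr oint; apply/funext => x; rewrite -ointD; [|exact: cont_oint_t_y..].
by congr oint; apply/funext => y; rewrite -ointD //; exact: cfield_t.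
Qed.

Lemma boxintZ L k f : cfield f ->
  boxint L (fun x y t => k * f x y t) = k * boxint L f.
Proof.
move=> cf; rewrite /boxint -ointZ; last exact: cont_oint_yt.
congr oint; apply/funext => x; rewrite -ointZ; last exact: cont_oint_t_y.
by congr oint; apply/funext => y; rewrite -ointZ //; exact: cfield_t.
Qed.

Lemma boxintN L f : cfield f -> boxint L (fun x y t => - f x y t) = - boxint L f.
Proof.
move=> cf; rewrite -mulN1r -boxintZ //.
by congr boxint; do 3!apply/funext => ?; rewrite mulN1r.
Qed.

Lemma boxint_sum L (F : 'I_3 -> R -> R -> R -> R) : (forall i, cfield (F i)) ->
  boxint L (fun x y t => \sum_(i < 3) F i x y t) = \sum_(i < 3) boxint L (F i).
Proof.
move=> cF; rewrite sum3 -!boxintD //; last exact: cfieldD.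
by congr boxint; do 3!apply/funext => ?; rewrite sum3.
Qed.

Lemma boxint_mono L M f : 0 <= L -> L <= M -> cfield f -> (forall x y t, 0 <= f x y t) ->
  boxint L f <= boxint M f.
Proof.
move=> L0 LM cf f0.
have Tge0 x y : 0 <= oint 0 1 (f x y) by apply: oint_ge0 => //; exact: cfield_t.
apply: (@le_trans _ _ (oint (- L) L (fun x => oint (- M) M (fun y => oint 0 1 (f x y))))).
  apply: le_oint => //; [exact: cont_oint_yt|exact: cont_oint_yt|lra|].
  by move=> x _; apply: le_oint_itv => //; [exact: cont_oint_t_y|lra..].
apply: le_oint_itv => //; [exact: cont_oint_yt|lra..|].
by move=> x; apply: oint_ge0 => //; [exact: cont_oint_t_y|lra].
Qed.

(** The two faces of the box [-L,L]^2 x [0,1] that are normal to the j-th axis. *)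
Definition zero_on_faces (j : 'I_3) L f : Prop := match val j with
  | 0%N => forall y t, f (- L) y t = 0 /\ f L y t = 0
  | 1%N => forall x t, f x (- L) t = 0 /\ f x L t = 0
  | _ => forall x y, f x y 0 = 0 /\ f x y 1 = 0
  end.

Lemma boxint_pd j L f g : cfield f -> cfield g -> pd j f g -> zero_on_faces j L f ->
  boxint L g = 0.
Proof.
move=> cf cg.
have swp h : cfield h -> forall y, continuous (fun z : R * R => h z.1 y z.2).
  by move=> ch y; apply: (cfield_comp ch); cont.
elim/ord3_ind: j => fg f0; rewrite /boxint.
- have d x : is_derive x 1 (fun x => oint (- L) L (fun y => oint 0 1 (f x y)))
      (oint (- L) L (fun y => oint 0 1 (g x y))).
    apply: (is_derive_oint_param (f := fun x y => oint 0 1 (f x y))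
      (g := fun x y => oint 0 1 (g x y))); [exact: cont_oint_t..|].
    move=> {}x y; apply: (is_derive_oint_param (f := fun x t => f x y t)
      (g := fun x t => g x y t)); [exact: swp..|].
    by move=> {}x t; exact: fg.
  rewrite (oint_FTC (- L) L (cont_oint_yt cg (L := L)) d).
  suff H x : (x = L) \/ (x = - L) -> oint (- L) L (fun y => oint 0 1 (f x y)) = 0.
    by rewrite !H ?subrr; [|right|left].
  move=> xL; rewrite (_ : (fun y => _) = fun=> 0) ?oint_cst ?mul0r //.
  apply/funext => y; rewrite (_ : f x y = fun=> 0) ?oint_cst ?mul0r //.
  by apply/funext => t; have [? ?] := f0 y t; case: xL => ->.
- rewrite (_ : (fun x => _) = fun=> 0) ?oint_cst ?mul0r //.
  apply/funext => x.
  have d y : is_derive y 1 (fun y => oint 0 1 (f x y)) (oint 0 1 (g x y)).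
    apply: (is_derive_oint_param (f := f x) (g := g x)).
    + by apply: (cfield_comp cf); cont.
    + by apply: (cfield_comp cg); cont.
    + by move=> {}y t; exact: fg.
  rewrite (oint_FTC (- L) L (cont_oint_t_y cg (x := x)) d).
  suff H y : (y = L) \/ (y = - L) -> oint 0 1 (f x y) = 0.
    by rewrite !H ?subrr; [|right|left].
  move=> yL; rewrite (_ : f x y = fun=> 0) ?oint_cst ?mul0r //.
  by apply/funext => t; have [? ?] := f0 x t; case: yL => ->.
- rewrite (_ : (fun x => _) = fun=> 0) ?oint_cst ?mul0r //.
  apply/funext => x.
  rewrite (_ : (fun y => _) = fun=> 0) ?oint_cst ?mul0r //.
  apply/funext => y.
  have cfxy : {within `[0, 1], continuous (f x y)}.
    exact/continuous_subspaceT/cfield_t.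
  have d t : 0 < t < 1 -> is_derive t 1 (f x y) (g x y t) by exact: fg.
  by rewrite (oint_FTC_oo (@cfield_t g cg x y) ler01 cfxy d); have [-> ->] := f0 x y; rewrite subrr.
Qed.

(** Divergence theorem on a box, for a field whose normal component vanishes on the
boundary. *)
Lemma boxint_div L (G dG : 'I_3 -> R -> R -> R -> R) :
  (forall j, cfield (G j)) -> (forall j, cfield (dG j)) ->
  (forall j, pd j (G j) (dG j)) -> (forall j, zero_on_faces j L (G j)) ->
  boxint L (fun x y t => \sum_(j < 3) dG j x y t) = 0.
Proof.
move=> cG cdG GdG G0; rewrite boxint_sum // big1 // => j _.
exact: (boxint_pd (cG j) (cdG j) (GdG j) (G0 j)).
Qed.

End Fields.

(** The analogue of [cont] for fields of three variables. *)
Ltac cfield :=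
  lazymatch goal with
  | |- cfield (fun _ _ _ => ?k) => exact: cfieldC
  | |- cfield (fun x y t => @?f x y t + @?g x y t) =>
      refine (@cfieldD _ f g _ _); cbv beta; cfield
  | |- cfield (fun x y t => @?f x y t * @?g x y t) =>
      refine (@cfieldM _ f g _ _); cbv beta; cfield
  | |- cfield (fun x y t => - @?f x y t) =>
      refine (@cfieldN _ f _); cbv beta; cfield
  | |- cfield (fun x y t => @?f x y t ^+ ?n) =>
      refine (@cfieldX _ f n _); cbv beta; cfield
  | |- cfield (fun x y t => \sum_(i < 3) @?F x y t i) =>
      refine (@cfield_sum _ (fun i x y t => F x y t i) _); intro; cbv beta; cfield
  | _ => match goal with
    | H : cfield ?g |- cfield ?g => exact H
    | H : cfield ?g |- cfield (fun x y t => ?g x y t) => exact H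
    | H : forall i, cfield (?g i) |- cfield (fun x y t => ?g ?k x y t) => exact (H k)
    | H : forall i, cfield (?g i) |- cfield (?g ?k) => exact (H k)
    | H : forall j i, cfield (?g j i) |- cfield (fun x y t => ?g ?k ?l x y t) => exact (H k l)
    | H : forall j i, cfield (?g j i) |- cfield (?g ?k ?l) => exact (H k l)
    | _ => idtac
    end
  end.

(** * The energy identity *)

Section FaceCombinators.
Context {R : realType}.
Implicit Types (f g : R -> R -> R -> R) (L : R).

Lemma zero_on_facesMl j L f g : zero_on_faces j L f ->
  zero_on_faces j L (fun x y t => f x y t * g x y t).
Proof.
by elim/ord3_ind: j; rewrite /zero_on_faces /= => H a b; have [-> ->] := H a b; rewrite !mul0r.
Qed.

Lemma zero_on_facesMr j L f g : zero_on_faces j L g ->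
  zero_on_faces j L (fun x y t => f x y t * g x y t).
Proof.
by elim/ord3_ind: j; rewrite /zero_on_faces /= => H a b; have [-> ->] := H a b; rewrite !mulr0.
Qed.

Lemma zero_on_facesD j L f g : zero_on_faces j L f -> zero_on_faces j L g ->
  zero_on_faces j L (fun x y t => f x y t + g x y t).
Proof.
by elim/ord3_ind: j; rewrite /zero_on_faces /= => H K a b;
  have [-> ->] := H a b; have [-> ->] := K a b; rewrite !addr0.
Qed.

Lemma zero_on_facesN j L f : zero_on_faces j L f -> zero_on_faces j L (fun x y t => - f x y t).
Proof.
by elim/ord3_ind: j; rewrite /zero_on_faces /= => H a b; have [-> ->] := H a b; rewrite !oppr0.
Qed.

Lemma zero_on_faces_sum j L (F : 'I_3 -> R -> R -> R -> R) : (forall i, zero_on_faces j L (F i)) ->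
  zero_on_faces j L (fun x y t => \sum_(i < 3) F i x y t).
Proof.
elim/ord3_ind: j; rewrite /zero_on_faces /= => H a b; split; apply: big1 => i _;
  by have [] := H i a b.
Qed.

End FaceCombinators.

Section Flow.
Context {R : realType}.
Notation field := (R -> R -> R -> R).

(** A stationary flow together with the derivatives occurring in the equations,
[du j i] standing for the j-th derivative of the i-th component and [ddu j i] for
its second derivative in the j-th direction. *)
Record flow (u : 'I_3 -> field) (du ddu : 'I_3 -> 'I_3 -> field)
    (p : field) (dp : 'I_3 -> field) : Prop := Flow {
  flow_cu : forall i, cfield (u i);
  flow_cdu : forall j i, cfield (du j i);
  flow_cddu : forall j i, cfield (ddu j i);
  flow_cp : cfield p;
  flow_cdp : forall j, cfield (dp j);
  flow_du : forall j i, pd j (u i) (du j i);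
  flow_ddu : forall j i, pd j (du j i) (ddu j i);
  flow_dp : forall j, pd j p (dp j);
  flow_momentum : forall i (x y t : R), 0 <= t <= 1 ->
    \sum_(j < 3) u j x y t * du j i x y t + dp i x y t
      - \sum_(j < 3) ddu j i x y t = 0;
  flow_div : forall x y t : R, 0 <= t <= 1 -> \sum_(j < 3) du j j x y t = 0;
  flow_noslip : forall i x y, u i x y 0 = 0 /\ u i x y 1 = 0 }.

Definition energy (du : 'I_3 -> 'I_3 -> field) : field :=
  fun x y t => \sum_(i < 3) \sum_(j < 3) du j i x y t ^+ 2.

(** What remains of the integrand when the momentum equation is tested with
phi u + z and phi |grad u|^2 is set apart: every term involves a derivative of phi
or the corrector z. *)
Definition energy_error (u : 'I_3 -> field) (du : 'I_3 -> 'I_3 -> field)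
    (dphi z : 'I_3 -> field) (dz : 'I_3 -> 'I_3 -> field) : field :=
  fun x y t =>
    \sum_(i < 3) \sum_(j < 3) dphi j x y t * u i x y t * du j i x y t
    + \sum_(i < 3) \sum_(j < 3) dz j i x y t * du j i x y t
    + \sum_(i < 3) \sum_(j < 3) z i x y t * (u j x y t * du j i x y t)
    - 2^-1 * \sum_(i < 3) \sum_(j < 3) dphi j x y t * u j x y t * u i x y t ^+ 2.

(** Pointwise form of the identity, in which capital letters are the values at a
point of u, p, z, of the gradient [P'] of p and of the derivatives [D] of u, [D2] of
[D] and [dZ] of z, and f is the gradient of phi.  The left-hand side is the divergence of
  p w + phi |u|^2 u / 2 - sum_i w_i grad u_i,  where w = phi u + z. *)
Lemma energy_divergence (U P' Z f : 'I_3 -> R) (D D2 dZ : 'I_3 -> 'I_3 -> R) (P phi : R) :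
  (forall i, \sum_(j < 3) U j * D j i + P' i - \sum_(j < 3) D2 j i = 0) ->
  \sum_(j < 3) D j j = 0 ->
  \sum_(j < 3) dZ j j = - \sum_(j < 3) f j * U j ->
  \sum_(j < 3)
     (P' j * (phi * U j + Z j) + P * (f j * U j + phi * D j j + dZ j j)
      + ((f j * (2^-1 * U j) + phi * (0 * U j + 2^-1 * D j j)) * (\sum_(i < 3) U i * U i)
         + phi * (2^-1 * U j) * \sum_(i < 3) (D j i * U i + U i * D j i))
      + - \sum_(i < 3) ((f j * U i + phi * D j i + dZ j i) * D j i
           + (phi * U i + Z i) * D2 j i))
  = - (phi * \sum_(i < 3) \sum_(j < 3) D j i ^+ 2
     + (\sum_(i < 3) \sum_(j < 3) f j * U i * D j i
        + \sum_(i < 3) \sum_(j < 3) dZ j i * D j i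
        + \sum_(i < 3) \sum_(j < 3) Z i * (U j * D j i)
        - 2^-1 * \sum_(i < 3) \sum_(j < 3) f j * U j * U i ^+ 2)).
Proof.
move=> hmom hdiv hdz.
set w := fun i => phi * U i + Z i.
have pressure : \sum_(j < 3) P * (f j * U j + phi * D j j + dZ j j) = 0.
  rewrite -mulr_sumr !big_split /= -mulr_sumr hdiv hdz; ring.
have force : \sum_(j < 3) (P' j * w j) - \sum_(i < 3) w i * \sum_(j < 3) D2 j i
    = - \sum_(i < 3) w i * \sum_(j < 3) U j * D j i.
  rewrite -sumrB -sumrN; apply: eq_bigr => i _.
  have -> : P' i = \sum_(j < 3) D2 j i - \sum_(j < 3) U j * D j i by have := hmom i; lra.
  ring.
have transport : \sum_(j < 3)
     ((f j * (2^-1 * U j) + phi * (0 * U j + 2^-1 * D j j)) * (\sum_(i < 3) U i * U i)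
         + phi * (2^-1 * U j) * \sum_(i < 3) (D j i * U i + U i * D j i))
   = 2^-1 * \sum_(i < 3) \sum_(j < 3) f j * U j * U i ^+ 2
     + phi * \sum_(i < 3) U i * \sum_(j < 3) U j * D j i.
  have e : D o2 o2 = - (D o0 o0 + D o1 o1) by move: hdiv; rewrite sum3; lra.
  by rewrite !sum3 e; field.
have dissipation : \sum_(j < 3) \sum_(i < 3) ((f j * U i + phi * D j i + dZ j i) * D j i
           + (phi * U i + Z i) * D2 j i)
   = phi * \sum_(i < 3) \sum_(j < 3) D j i ^+ 2
     + \sum_(i < 3) \sum_(j < 3) f j * U i * D j i
     + \sum_(i < 3) \sum_(j < 3) dZ j i * D j i
     + \sum_(i < 3) w i * \sum_(j < 3) D2 j i.
  rewrite exchange_big mulr_sumr -!big_split /=; apply: eq_bigr => i _.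
  by rewrite !mulr_sumr -!big_split /=; apply: eq_bigr => j _; rewrite /w; ring.
have convection : \sum_(i < 3) w i * \sum_(j < 3) U j * D j i
   = phi * \sum_(i < 3) U i * \sum_(j < 3) U j * D j i
     + \sum_(i < 3) \sum_(j < 3) Z i * (U j * D j i).
  rewrite mulr_sumr -big_split /=; apply: eq_bigr => i _.
  by rewrite /w -[in RHS]mulr_sumr; ring.
have split4 (A B C E : 'I_3 -> R) : \sum_(j < 3) (A j + B j + C j + - E j)
    = \sum_(j < 3) A j + \sum_(j < 3) B j + \sum_(j < 3) C j - \sum_(j < 3) E j.
  by rewrite -sumrN -!big_split.
rewrite split4 pressure transport dissipation.
by move: force convection; rewrite /w; lra.
Qed.

(** The momentum equation tested with phi u + z: the three fluxes of
[energy_divergence] vanish on the boundary of the box, because phi and z vanish on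
its vertical faces and u and z on the horizontal ones. *)
Lemma energy_identity u du ddu p dp (L : R) phi dphi z dz :
  flow u du ddu p dp -> 0 <= L ->
  cfield phi -> (forall j, cfield (dphi j)) -> (forall j, pd j phi (dphi j)) ->
  (forall i, cfield (z i)) -> (forall j i, cfield (dz j i)) ->
  (forall j i, pd j (z i) (dz j i)) ->
  zero_on_faces o0 L phi -> zero_on_faces o1 L phi -> (forall j i, zero_on_faces j L (z i)) ->
  (forall x y t : R, 0 <= t <= 1 ->
    \sum_(j < 3) dz j j x y t = - \sum_(j < 3) dphi j x y t * u j x y t) ->
  boxint L (fun x y t => phi x y t * energy du x y t)
    = - boxint L (energy_error u du dphi z dz).
Proof.
move=> [cu cdu cddu cp cdp hu hdu hp mom dvg bc] L0 cphi cdphi hphi cz cdz hz f0 f1 fz divz.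
pose G (j : 'I_3) : field := fun x y t =>
  p x y t * (phi x y t * u j x y t + z j x y t)
  + phi x y t * (2^-1 * u j x y t) * (\sum_(i < 3) u i x y t * u i x y t)
  + - \sum_(i < 3) (phi x y t * u i x y t + z i x y t) * du j i x y t.
pose dG (j : 'I_3) : field := fun x y t =>
  dp j x y t * (phi x y t * u j x y t + z j x y t)
  + p x y t * (dphi j x y t * u j x y t + phi x y t * du j j x y t + dz j j x y t)
  + ((dphi j x y t * (2^-1 * u j x y t)
      + phi x y t * (0 * u j x y t + 2^-1 * du j j x y t))
       * (\sum_(i < 3) u i x y t * u i x y t)
     + phi x y t * (2^-1 * u j x y t)
       * \sum_(i < 3) (du j i x y t * u i x y t + u i x y t * du j i x y t))
  + - \sum_(i < 3) ((dphi j x y t * u i x y t + phi x y t * du j i x y t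
        + dz j i x y t) * du j i x y t
      + (phi x y t * u i x y t + z i x y t) * ddu j i x y t).
have cG j : cfield (G j) by rewrite /G; cfield.
have cdG j : cfield (dG j) by rewrite /dG; cfield.
have hG j : pd j (G j) (dG j).
  apply: pdD; [apply: pdD|apply: pdN].
  - by apply: pdM => //; apply: pdD => //; apply: pdM.
  - apply: pdM; last by apply: pd_sum => i; apply: pdM.
    by apply: pdM => //; apply: pdM => //; exact: pdC.
  - by apply: pd_sum => i; apply: pdM => //; apply: pdD => //; apply: pdM.
have fphiu j i : zero_on_faces j L (fun x y t => phi x y t * u i x y t).
  by elim/ord3_ind: j;
    [exact: zero_on_facesMl|exact: zero_on_facesMl|apply: zero_on_facesMr => x y; exact: bc].
have fG j : zero_on_faces j L (G j).
  apply: zero_on_facesD; [apply: zero_on_facesD|apply: zero_on_facesN].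
  - by apply: zero_on_facesMr; apply: zero_on_facesD.
  - apply: zero_on_facesMl; elim/ord3_ind: j; [exact: zero_on_facesMl|exact: zero_on_facesMl|].
    by apply: zero_on_facesMr; apply: zero_on_facesMr => x y; exact: bc.
  - by apply: zero_on_faces_sum => i; apply: zero_on_facesMl; apply: zero_on_facesD.
have := boxint_div cG cdG hG fG.
have cerr : cfield (energy_error u du dphi z dz) by rewrite /energy_error; cfield.
have ce : cfield (energy du) by rewrite /energy; cfield.
have cphie : cfield (fun x y t => phi x y t * energy du x y t) by cfield.
rewrite (@eq_boxint _ _ _ (fun x y t =>
  - (phi x y t * energy du x y t + energy_error u du dphi z dz x y t))) //.
- by rewrite (boxintN L (cfieldD cphie cerr)) (boxintD L cphie cerr); lra.
- by rewrite /dG; cfield.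
- by cfield.
- move=> x y t _ _ t01; rewrite /energy /energy_error /dG.
  apply: energy_divergence (fun i => mom i x y t t01) (dvg x y t t01) (divz x y t t01).
Qed.

End Flow.

(** * Stream functions, vertical averages and gauges *)

Section StreamFunction.
Context {R : realType}.
Implicit Types (V W a psi : R -> R -> R) (x y L : R).

Definition cplane V := continuous (fun z : R * R => V z.1 z.2).

Lemma cplane_comp (T : topologicalType) V (a b : T -> R) : cplane V ->
  continuous a -> continuous b -> continuous (fun w => V (a w) (b w)).
Proof. exact: cont_comp2. Qed.

(** psi(x,y) integrates W along the horizontal line from (x0,y) to (x,y), after
having integrated -V along the vertical line from (x0,0) to (x0,y); its derivative
in y is found by differentiating under the integral sign, as the y-derivative of W
is minus the x-derivative of V.  The abscissa x0 is where the integral of V^2 over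
a vertical segment equals its mean, so that Cauchy-Schwarz on the two lines bounds
the L^2 norm of psi by L times that of (V,W): a Poincaré inequality for psi, with
the additive constant fixed by psi(x0,0) = 0. *)
Lemma stream_function V W a L : 0 < L -> cplane V -> cplane W -> cplane a ->
  (forall x y, is_derive x (1 : R) (V ^~ y) (a x y)) ->
  (forall x y, is_derive y (1 : R) (W x) (- a x y)) ->
  exists psi, [/\ cplane psi,
    (forall x y, is_derive x (1 : R) (psi ^~ y) (W x y)),
    (forall x y, is_derive y (1 : R) (psi x) (- V x y)) &
    oint (- L) L (fun x => oint (- L) L (fun y => psi x y ^+ 2)) <=
    8 * L ^+ 2 * (oint (- L) L (fun x => oint (- L) L (fun y => V x y ^+ 2))
                + oint (- L) L (fun x => oint (- L) L (fun y => W x y ^+ 2)))].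
Proof.
move=> L0 cV cW ca dV dW; have LL : - L <= L by lra.
have cVx x : continuous (V x) by apply: (cplane_comp cV); cont.
have cWy y : continuous (W ^~ y) by apply: (cplane_comp cW); cont.
have cay y : continuous (a ^~ y) by apply: (cplane_comp ca); cont.
have cV2 : cplane (fun x y => V x y ^+ 2) by exact: contX.
have cW2 : cplane (fun x y => W x y ^+ 2) by exact: contX.
have cW2' : cplane (fun y x => W x y ^+ 2) by apply: contX; apply: (cplane_comp cW); cont.
have cg : continuous (fun x => oint (- L) L (fun y => V x y ^+ 2)).
  by apply: (@cont_oint R _ (fun x y => V x y ^+ 2) (fun=> - L) (fun=> L)); cont.
have cg' : continuous (fun y => oint (- L) L (fun x => W x y ^+ 2)).
  by apply: (@cont_oint R _ (fun y x => W x y ^+ 2) (fun=> - L) (fun=> L)); cont.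
(* mean value theorem for the integral of V^2 over vertical segments *)
have [x0 x0L hx0] := oint_MVT cg LL.
pose psi x y := - oint 0 y (V x0) + oint x0 x (W ^~ y).
have cpsi : cplane psi.
  apply: contD; first apply: contN.
    apply: (@cont_oint R (R * R)%type (fun _ s => V x0 s) (fun=> 0) snd); cont.
    by apply: (cplane_comp cV); cont.
  apply: (@cont_oint R (R * R)%type (fun z s => W s z.2) (fun=> x0) fst); cont.
  by apply: (cplane_comp cW); cont.
exists psi; split => //.
- move=> x y; have := derD (derC (- oint 0 y (V x0)) x) (is_derive_oint x0 x (cWy y)).
  by rewrite add0r.
- move=> x y.
  have e : oint x0 x (a ^~ y) = V x y - V x0 y.
    exact: (oint_FTC x0 x (cay y) (fun x => dV x y)).
  have d1 : is_derive y 1 (fun y => oint x0 x (W ^~ y)) (oint x0 x (fun s => - a s y)).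
    apply: (is_derive_oint_param (f := fun y s => W s y) (g := fun y s => - a s y)).
    + by apply: (cplane_comp cW); cont.
    + by apply: contN; apply: (cplane_comp ca); cont.
    + by move=> y' s; exact: dW.
  have d2 : is_derive y 1 (fun y => - oint 0 y (V x0)) (- V x0 y).
    by apply: derN; exact: is_derive_oint.
  have := derD d2 d1.
  have -> : oint x0 x (fun s => - a s y) = - oint x0 x (a ^~ y).
    rewrite -mulN1r -ointZ //; congr oint; apply/funext => s; rewrite mulN1r //.
  by rewrite e opprB addKr.
- pose c0 := oint (- L) L (fun y => V x0 y ^+ 2).
  have bnd x y : - L <= x <= L -> - L <= y <= L ->
      psi x y ^+ 2 <= 4 * L * c0 + 4 * L * oint (- L) L (fun x => W x y ^+ 2).
    move=> hx hy; have l0 : - L <= 0 <= L by lra.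
    have h1 := sqr_oint_le (cVx x0) l0 hy.
    have h2 := sqr_oint_le (cWy y) x0L hx.
    rewrite /psi /c0; set A := oint 0 y _ in h1 *; set B := oint x0 x _ in h2 *.
    have := sqr_ge0 (A + B); lra.
  have cb : continuous (fun y => 4 * L * c0 + 4 * L * oint (- L) L (fun x => W x y ^+ 2)).
    by cont.
  have cpsi2 : cplane (fun x y => psi x y ^+ 2) by exact: contX.
  apply: (@le_trans _ _ (oint (- L) L (fun x => oint (- L) L (fun y =>
      4 * L * c0 + 4 * L * oint (- L) L (fun x => W x y ^+ 2))))).
    apply: le_oint => //.
    + by apply: (@cont_oint R _ (fun x y => psi x y ^+ 2) (fun=> - L) (fun=> L)); cont.
    + by cont.
    + move=> x hx; apply: le_oint => //; last by move=> y; exact: bnd.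
      by apply: contX; apply: (cplane_comp cpsi); cont.
  rewrite oint_cst (ointD (f := fun=> 4 * L * c0)); [|by cont|by cont].
  rewrite oint_cst ointZ // -(oint_exchange (- L) L (- L) L cW2) hx0 -/c0.
  lra.
Qed.

End StreamFunction.

Section Coordinates.
Context {R : realType}.
Implicit Types (f df : R -> R) (V W : R -> R -> R).

Lemma pdx j f df : (forall x, is_derive x (1 : R) f (df x)) ->
  pd j (fun x _ _ => f x) (fun x _ _ => if j == o0 then df x else 0).
Proof. by move=> H; elim/ord3_ind: j; rewrite /pd /= => *; [exact: H|exact: derC..]. Qed.

Lemma pdy j f df : (forall x, is_derive x (1 : R) f (df x)) ->
  pd j (fun _ y _ => f y) (fun _ y _ => if j == o1 then df y else 0).
Proof. by move=> H; elim/ord3_ind: j; rewrite /pd /= => *; [exact: derC|exact: H|exact: derC]. Qed.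

Lemma pdt j f df : (forall x, is_derive x (1 : R) f (df x)) ->
  pd j (fun _ _ t => f t) (fun _ _ t => if j == o2 then df t else 0).
Proof. by move=> H; elim/ord3_ind: j; rewrite /pd /= => *; [exact: derC..|exact: H]. Qed.

Lemma pdxy j V W W' : (forall x y, is_derive x (1 : R) (V ^~ y) (W x y)) ->
  (forall x y, is_derive y (1 : R) (V x) (W' x y)) ->
  pd j (fun x y _ => V x y) (fun x y _ => if j == o0 then W x y else if j == o1 then W' x y else 0).
Proof.
by move=> H K; elim/ord3_ind: j; rewrite /pd /= => *; [exact: H|exact: K|exact: derC].
Qed.

Lemma cfield_x f : continuous f -> cfield (fun x _ _ => f x).
Proof. by move=> cf; apply: (cont_comp cf); cont. Qed.

Lemma cfield_y f : continuous f -> cfield (fun _ y _ => f y).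
Proof. by move=> cf; apply: (cont_comp cf); cont. Qed.

Lemma cfield_z f : continuous f -> cfield (fun _ _ t => f t).
Proof. by move=> cf; apply: (cont_comp cf); cont. Qed.

Lemma cfield_xy V : cplane V -> cfield (fun x y _ => V x y).
Proof. by move=> cV; apply: (cplane_comp cV); cont. Qed.

End Coordinates.

Section SlabAverage.
Context {R : realType}.
Notation field := (R -> R -> R -> R).
Implicit Types (f g : field) (x y t L : R).

(** Kept as a field, constant in t, so that it can be integrated over boxes. *)
Definition height_mean f : field := fun x y _ => oint 0 1 (f x y).

Lemma cfield_height_mean f : cfield f -> cfield (height_mean f).
Proof. by move=> cf; apply: cfield_xy; exact: cont_oint_t. Qed.

Lemma boxint_height_mean L f : boxint L (height_mean f) = boxint L f.
Proof.
rewrite /boxint; congr oint; apply/funext => x; congr oint; apply/funext => y.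
by rewrite /height_mean oint_cst subr0 mulr1.
Qed.

Lemma le_height_mean f g x y t : cfield f -> cfield g ->
  (forall s, 0 <= s <= 1 -> f x y s <= g x y s) -> height_mean f x y t <= height_mean g x y t.
Proof. by move=> cf cg fg; apply: le_oint => //; exact: cfield_t. Qed.

Lemma sqr_oint_height_mean f x y s t : cfield f -> 0 <= s <= 1 -> 0 <= t <= 1 ->
  oint s t (f x y) ^+ 2 <= height_mean (fun x y t => f x y t ^+ 2) x y t.
Proof.
move=> cf s01 t01; have := sqr_oint_le (@cfield_t _ f cf x y) s01 t01.
by rewrite subr0 mul1r.
Qed.

(** The ramp climbs from 0 to 1 with zero slope at both ends; its derivative [bell]
has integral 1 and vanishes on both planes. *)
Definition ramp (t : R) := t ^+ 2 * (3 - 2 * t).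
Definition bell (t : R) := 6 * t * (1 - t).
Definition dbell (t : R) := 6 - 12 * t.

Lemma is_derive_ramp t : is_derive t 1 ramp (bell t).
Proof.
have d := derM (derM (is_derive_id t (1:R)) (is_derive_id t (1:R)))
  (derD (derC (3:R) t) (derN (derM (derC (2:R) t) (is_derive_id t (1:R))))).
by apply: (is_derive_eq d); rewrite /bell; ring.
Qed.

Lemma is_derive_bell t : is_derive t 1 bell (dbell t).
Proof.
have d := derM (derM (derC (6:R) t) (is_derive_id t (1:R)))
  (derD (derC (1:R) t) (derN (is_derive_id t (1:R)))).
by apply: (is_derive_eq d); rewrite /dbell; ring.
Qed.

(** The primitive of f in the vertical direction, corrected so as to vanish on the
upper plane as well. *)
Definition gauge f : field := fun x y t => oint 0 t (f x y) - ramp t * oint 0 1 (f x y).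

Lemma cont_ramp : continuous ramp. Proof. by rewrite /ramp; cont. Qed.
Lemma cont_bell : continuous bell. Proof. by rewrite /bell; cont. Qed.
Lemma cont_dbell : continuous dbell. Proof. by rewrite /dbell; cont. Qed.

Lemma cfield_gauge f : cfield f -> cfield (gauge f).
Proof.
move=> cf; apply: cfieldD; last apply: cfieldN; last apply: cfieldM.
- apply: (@cont_oint R (R * R * R)%type (fun z s => f z.1.1 z.1.2 s) (fun=> 0) snd); cont.
  by apply: (cfield_comp cf); cont.
- exact/cfield_z/cont_ramp.
- exact: cfield_height_mean.
Qed.

Lemma gauge0 f x y : gauge f x y 0 = 0.
Proof. by rewrite /gauge oint_aa /ramp expr0n /= !mul0r subrr. Qed.

Lemma gauge1 f x y : gauge f x y 1 = 0.
Proof. by rewrite /gauge /ramp expr1n; lra. Qed.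

Lemma pd_height_mean (j : 'I_3) f g : j != o2 -> cfield f -> cfield g -> pd j f g ->
  pd j (height_mean f) (height_mean g).
Proof.
move=> j2 cf cg; elim/ord3_ind: j j2 => //; rewrite /pd /height_mean /= => _ fg x y t.
- apply: (is_derive_oint_param (f := fun x t => f x y t) (g := fun x t => g x y t)).
  + by apply: (cfield_comp cf); cont.
  + by apply: (cfield_comp cg); cont.
- apply: (is_derive_oint_param (f := f x) (g := g x)).
  + by apply: (cfield_comp cf); cont.
  + by apply: (cfield_comp cg); cont.
Qed.

Lemma pd_gauge (j : 'I_3) f g : j != o2 -> cfield f -> cfield g -> pd j f g ->
  pd j (gauge f) (gauge g).
Proof.
move=> j2 cf cg fg; apply: pdD.
  elim/ord3_ind: j j2 fg => //; rewrite /pd /= => _ fg x y t.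
  - apply: (is_derive_oint_param (f := fun x t => f x y t) (g := fun x t => g x y t)).
    + by apply: (cfield_comp cf); cont.
    + by apply: (cfield_comp cg); cont.
  - apply: (is_derive_oint_param (f := f x) (g := g x)).
    + by apply: (cfield_comp cf); cont.
    + by apply: (cfield_comp cg); cont.
apply: pdN; have d := pdM (pdt j is_derive_ramp) (pd_height_mean j2 cf cg fg).
by apply: pd_ext d _ => x y t; rewrite (negbTE j2) mul0r add0r.
Qed.

Lemma pd_gauge2 f : cfield f ->
  pd o2 (gauge f) (fun x y t => f x y t - bell t * oint 0 1 (f x y)).
Proof.
move=> cf; rewrite /pd /= => x y t _; apply: derD.
  by apply: is_derive_oint; exact: cfield_t.
apply: derN; have := derM (is_derive_ramp t) (derC (oint 0 1 (f x y)) t).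
by rewrite mulr0 addr0.
Qed.

(** The two integrals in [gauge] are each controlled by Cauchy-Schwarz. *)
Lemma sqr_gauge_le f x y t : cfield f -> 0 <= t <= 1 ->
  gauge f x y t ^+ 2 <= 4 * height_mean (fun x y t => f x y t ^+ 2) x y t.
Proof.
move=> cf t01; have z01 : 0 <= (0 : R) <= 1 by lra.
have o01 : 0 <= (1 : R) <= 1 by lra.
have h1 := sqr_oint_height_mean x y cf z01 t01.
have h2 := sqr_oint_height_mean x y cf z01 o01.
have [r0 r1] : 0 <= ramp t /\ ramp t <= 1.
  rewrite /ramp; split; first by apply: mulr_ge0; [exact: sqr_ge0|lra].
  by have := mulr_ge0 (sqr_ge0 (1 - t)) (_ : 0 <= 1 + 2 * t); lra.
have h3 : (ramp t * oint 0 1 (f x y)) ^+ 2 <= height_mean (fun x y t => f x y t ^+ 2) x y t.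
  apply: le_trans h2; rewrite exprMn ler_piMl ?sqr_ge0 //.
  by rewrite expr_le1.
have := sqr_ge0 (oint 0 t (f x y) + ramp t * oint 0 1 (f x y)).
by rewrite /gauge; lra.
Qed.

End SlabAverage.

(** * The polynomial cutoff *)

Section Cutoff.
Context {R : realType}.
Notation field := (R -> R -> R -> R).
Implicit Types (x y t l s : R).

(** l stands for 1/L.  A polynomial with a double zero at both ends of [-L,L] is as
good as a smooth cutoff when integrating over a box, and its slope is
proportional to s near 0. *)
Definition profile l s := (1 - (s * l) ^+ 2) ^+ 2.
Definition dprofile l s := - 4 * l * (s * l) * (1 - (s * l) ^+ 2).
Definition ddprofile l s := - 4 * l ^+ 2 * (1 - 3 * (s * l) ^+ 2).

Lemma is_derive_sl l s : is_derive s 1 (fun s => s * l) l.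
Proof.
have d := derM (is_derive_id s (1:R)) (derC l s).
by apply: (is_derive_eq d); ring.
Qed.

Lemma is_derive_1sl2 l s : is_derive s 1 (fun s => 1 - (s * l) ^+ 2) (- 2 * l * (s * l)).
Proof.
have d := derD (derC (1:R) s) (derN (derM (is_derive_sl l s) (is_derive_sl l s))).
by apply: (is_derive_eq d); ring.
Qed.

Lemma is_derive_profile l s : is_derive s 1 (profile l) (dprofile l s).
Proof.
have d := derM (is_derive_1sl2 l s) (is_derive_1sl2 l s).
by apply: (is_derive_eq d); rewrite /dprofile; ring.
Qed.

Lemma is_derive_dprofile l s : is_derive s 1 (dprofile l) (ddprofile l s).
Proof.
have d := derM (derM (derC (- 4 * l) s) (is_derive_sl l s)) (is_derive_1sl2 l s).
by apply: (is_derive_eq d); rewrite /ddprofile; ring.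
Qed.

Lemma cont_profile l : continuous (profile l).
Proof. by rewrite /profile; cont. Qed.
Lemma cont_dprofile l : continuous (dprofile l).
Proof. by rewrite /dprofile; cont. Qed.
Lemma cont_ddprofile l : continuous (ddprofile l).
Proof. by rewrite /ddprofile; cont. Qed.

Definition cutoff l : field := fun x y _ => profile l x * profile l y.

Definition dcutoff l (j : 'I_3) : field := fun x y _ => match val j with
  | 0%N => dprofile l x * profile l y | 1%N => profile l x * dprofile l y | _ => 0 end.

Definition ddcutoff l (j k : 'I_3) : field := fun x y _ => match val j, val k with
  | 0%N, 0%N => ddprofile l x * profile l y
  | 0%N, 1%N | 1%N, 0%N => dprofile l x * dprofile l y
  | 1%N, 1%N => profile l x * ddprofile l y
  | _, _ => 0 end.

Lemma cfield_profilex l : cfield (fun x _ _ => profile l x).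
Proof. exact/cfield_x/cont_profile. Qed.
Lemma cfield_profiley l : cfield (fun _ y _ => profile l y).
Proof. exact/cfield_y/cont_profile. Qed.
Lemma cfield_dprofilex l : cfield (fun x _ _ => dprofile l x).
Proof. exact/cfield_x/cont_dprofile. Qed.
Lemma cfield_dprofiley l : cfield (fun _ y _ => dprofile l y).
Proof. exact/cfield_y/cont_dprofile. Qed.
Lemma cfield_ddprofilex l : cfield (fun x _ _ => ddprofile l x).
Proof. exact/cfield_x/cont_ddprofile. Qed.
Lemma cfield_ddprofiley l : cfield (fun _ y _ => ddprofile l y).
Proof. exact/cfield_y/cont_ddprofile. Qed.

Lemma cfield_cutoff l : cfield (cutoff l).
Proof. apply: cfieldM; [exact: cfield_profilex|exact: cfield_profiley]. Qed.

Lemma cfield_dcutoff l j : cfield (dcutoff l j).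
Proof.
elim/ord3_ind: j; rewrite /dcutoff /=.
- apply: cfieldM; [exact: cfield_dprofilex|exact: cfield_profiley].
- apply: cfieldM; [exact: cfield_profilex|exact: cfield_dprofiley].
- exact: cfieldC.
Qed.

Lemma cfield_ddcutoff l j k : cfield (ddcutoff l j k).
Proof.
elim/ord3_ind: j; elim/ord3_ind: k; rewrite /ddcutoff /=; try exact: cfieldC.
- apply: cfieldM; [exact: cfield_ddprofilex|exact: cfield_profiley].
- apply: cfieldM; [exact: cfield_dprofilex|exact: cfield_dprofiley].
- apply: cfieldM; [exact: cfield_dprofilex|exact: cfield_dprofiley].
- apply: cfieldM; [exact: cfield_profilex|exact: cfield_ddprofiley].
Qed.

Lemma pd_cutoff l j : pd j (cutoff l) (dcutoff l j).
Proof.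
have := pdM (pdx j (is_derive_profile l)) (pdy j (is_derive_profile l)).
by move=> d; apply: pd_ext d _; elim/ord3_ind: j => x y t; rewrite /dcutoff /=; ring.
Qed.

Lemma pd_dcutoff l j k : pd j (dcutoff l k) (ddcutoff l j k).
Proof.
elim/ord3_ind: k.
- have := pdM (pdx j (is_derive_dprofile l)) (pdy j (is_derive_profile l)).
  by move=> d; apply: pd_ext d _; elim/ord3_ind: j => x y t; rewrite /ddcutoff /=; ring.
- have := pdM (pdx j (is_derive_profile l)) (pdy j (is_derive_dprofile l)).
  by move=> d; apply: pd_ext d _; elim/ord3_ind: j => x y t; rewrite /ddcutoff /=; ring.
- apply: pd_ext (pdC j 0) _.
  by elim/ord3_ind: j => x y t; rewrite /ddcutoff /=.
Qed.

Section Bounds.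
Variables (L : R) (L1 : 1 <= L).
Let l := L^-1.
Let L0 : 0 < L. Proof. by apply: lt_le_trans L1. Qed.
Let l0 : 0 < l. Proof. by rewrite invr_gt0. Qed.
Let l1 : l <= 1. Proof. by rewrite invf_le1. Qed.
Let lL : l * L = 1. Proof. by rewrite mulVf // gt_eqF. Qed.

Lemma scaled_sqr_le1 s : - L <= s <= L -> 0 <= (s * l) ^+ 2 <= 1.
Proof.
move=> /andP[Ls sL]; rewrite sqr_ge0 /=.
have := ler_wpM2r (ltW l0) Ls; have := ler_wpM2r (ltW l0) sL.
rewrite mulNr [L * l]mulrC lL; nra.
Qed.

Lemma profile_bounds s : - L <= s <= L -> 0 <= profile l s <= 1.
Proof. by move=> /scaled_sqr_le1; rewrite /profile; nra. Qed.

Lemma sqr_dprofile_le s : - L <= s <= L -> (dprofile l s) ^+ 2 <= 16 * l ^+ 2 * (s * l) ^+ 2.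
Proof.
move=> /scaled_sqr_le1; rewrite /dprofile; set q := s * l => q1.
rewrite (_ : (- 4 * l * q * _) ^+ 2 = 16 * l ^+ 2 * q ^+ 2 * (1 - q ^+ 2) ^+ 2); last by ring.
apply: ler_piMr; first by do 2!(apply: mulr_ge0 => //; try exact: sqr_ge0).
by rewrite expr_le1 //; lra.
Qed.

Lemma dprofile_bounds s : - L <= s <= L -> `|dprofile l s| <= 4 * l.
Proof.
move=> sL; rewrite -ler_sqr ?nnegrE //; last by rewrite mulr_ge0 // ltW.
rewrite real_normK ?num_real //; apply: le_trans (sqr_dprofile_le sL) _.
have /andP[_ q1] := scaled_sqr_le1 sL.
rewrite (_ : (4 * l) ^+ 2 = 16 * l ^+ 2); last by ring.
by apply: ler_piMr => //; apply: mulr_ge0 => //; exact: sqr_ge0.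
Qed.

Lemma ddprofile_bounds s : - L <= s <= L -> `|ddprofile l s| <= 8 * l ^+ 2.
Proof.
move=> /scaled_sqr_le1 q1; rewrite /ddprofile normrM.
have l2 : 0 <= l ^+ 2 by exact: sqr_ge0.
rewrite (_ : 8 * l ^+ 2 = 4 * l ^+ 2 * 2); last by ring.
apply: ler_pM => //; first by rewrite ler_norml; lra.
by rewrite ler_norml; lra.
Qed.

Lemma dcutoff_bound j x y t : - L <= x <= L -> - L <= y <= L ->
  `|dcutoff l j x y t| <= 4 * l.
Proof.
move=> xL yL; have /andP[ex0 ex1] := profile_bounds xL; have /andP[ey0 ey1] := profile_bounds yL.
have dx := dprofile_bounds xL; have dy := dprofile_bounds yL.
elim/ord3_ind: j; rewrite /dcutoff /=.
- by rewrite normrM -[leRHS]mulr1; apply: ler_pM => //; rewrite ger0_norm.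
- by rewrite normrM -[leRHS]mul1r; apply: ler_pM => //; rewrite ger0_norm.
- by rewrite normr0 mulr_ge0 // ltW.
Qed.

(** The factor (x^2 + y^2)/L^2 makes this bound small where most of the energy sits;
it does the work that, for a cutoff equal to 1 near the origin, is done by the
support of the gradient. *)
Lemma sqr_dcutoff_bound j x y t : - L <= x <= L -> - L <= y <= L ->
  (dcutoff l j x y t * L) ^+ 2 <= 16 * ((x * l) ^+ 2 + (y * l) ^+ 2).
Proof.
move=> xL yL; have /andP[ex0 ex1] := profile_bounds xL; have /andP[ey0 ey1] := profile_bounds yL.
have dx := sqr_dprofile_le xL; have dy := sqr_dprofile_le yL.
have x2 := sqr_ge0 (x * l); have y2 := sqr_ge0 (y * l).
have aux (d q e : R) : d ^+ 2 <= 16 * l ^+ 2 * q -> 0 <= q -> 0 <= e -> e <= 1 ->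
    (d * e * L) ^+ 2 <= 16 * q.
  move=> dq q0 e0 e1; rewrite (_ : (d * e * L) ^+ 2 = d ^+ 2 * L ^+ 2 * e ^+ 2); last by ring.
  apply: (@le_trans _ _ (d ^+ 2 * L ^+ 2)).
    by apply: ler_piMr; [rewrite mulr_ge0 ?sqr_ge0|rewrite expr_le1].
  apply: (@le_trans _ _ (16 * l ^+ 2 * q * L ^+ 2)).
    by apply: ler_wpM2r => //; exact: sqr_ge0.
  have -> : 16 * l ^+ 2 * q * L ^+ 2 = 16 * q * (l * L) ^+ 2 by ring.
  by rewrite lL expr1n mulr1.
elim/ord3_ind: j; rewrite /dcutoff /=.
- by apply: le_trans (aux _ _ _ dx _ ey0 ey1) _ => //; lra.
- by rewrite [profile l x * _]mulrC; apply: le_trans (aux _ _ _ dy _ ex0 ex1) _ => //; lra.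
- by rewrite mul0r expr0n /=; lra.
Qed.

Lemma ddcutoff_bound j k x y t : - L <= x <= L -> - L <= y <= L ->
  `|ddcutoff l j k x y t| <= 16 * l ^+ 2.
Proof.
move=> xL yL; have /andP[ex0 ex1] := profile_bounds xL; have /andP[ey0 ey1] := profile_bounds yL.
have dx := dprofile_bounds xL; have dy := dprofile_bounds yL.
have ddx := ddprofile_bounds xL; have ddy := ddprofile_bounds yL.
have l2 : 0 <= l ^+ 2 by exact: sqr_ge0.
have B1 (a b : R) : `|a| <= 8 * l ^+ 2 -> 0 <= b -> b <= 1 -> `|a * b| <= 16 * l ^+ 2.
  move=> ha b0 b1; rewrite normrM (ger0_norm b0).
  by apply: (@le_trans _ _ `|a|); [rewrite ler_piMr|lra].
have B2 : `|dprofile l x * dprofile l y| <= 16 * l ^+ 2.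
  by rewrite normrM (_ : 16 * l ^+ 2 = 4 * l * (4 * l)); [exact: ler_pM|ring].
have B0 : `|0 : R| <= 16 * l ^+ 2 by rewrite normr0; lra.
by elim/ord3_ind: j; elim/ord3_ind: k; rewrite /ddcutoff //=; [exact: B1|rewrite mulrC; exact: B1].
Qed.

(** With X = (x/L)^2 and Y = (y/L)^2, one has phi <= (1 - X)(1 - Y), and
1 - (1 - X)(1 - Y) = X + Y - XY is at least (X + Y)/2. *)
Lemma cutoff_weight x y t : - L <= x <= L -> - L <= y <= L ->
  (x * l) ^+ 2 + (y * l) ^+ 2 <= 2 * (1 - cutoff l x y t).
Proof.
move=> /scaled_sqr_le1 hx /scaled_sqr_le1 hy; rewrite /cutoff /profile.
move: hx hy; set X := (x * l) ^+ 2; set Y := (y * l) ^+ 2 => hx hy.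
have h : 0 <= (1 - X) * (1 - Y) <= 1.
  by apply/andP; split; [apply: mulr_ge0; lra|apply: mulr_ile1; lra].
have : ((1 - X) * (1 - Y)) ^+ 2 <= (1 - X) * (1 - Y).
  by rewrite expr2 ler_piMl //; lra.
have : 0 <= (1 - X) * Y by apply: mulr_ge0; lra.
have : 0 <= (1 - Y) * X by apply: mulr_ge0; lra.
by rewrite exprMn; lra.
Qed.

Lemma cutoff_faces : zero_on_faces o0 L (cutoff l) /\ zero_on_faces o1 L (cutoff l).
Proof.
have e1 : profile l L = 0 by rewrite /profile mulrC lL expr1n subrr expr0n.
have e2 : profile l (- L) = 0 by rewrite /profile mulNr sqrrN mulrC lL expr1n subrr expr0n.
by split; rewrite /zero_on_faces /cutoff /= => *; rewrite e1 e2 ?mul0r ?mulr0.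
Qed.

Lemma dcutoff_faces j k : j != o2 -> zero_on_faces j L (dcutoff l k).
Proof.
have e1 : profile l L = 0 by rewrite /profile mulrC lL expr1n subrr expr0n.
have e2 : profile l (- L) = 0 by rewrite /profile mulNr sqrrN mulrC lL expr1n subrr expr0n.
have e3 : dprofile l L = 0 by rewrite /dprofile [L * l]mulrC lL expr1n subrr mulr0.
have e4 : dprofile l (- L) = 0.
  by rewrite /dprofile [- L * l]mulNr sqrrN [L * l]mulrC lL expr1n subrr mulr0.
elim/ord3_ind: j => // _; elim/ord3_ind: k; rewrite /zero_on_faces /dcutoff /= => *;
  by rewrite ?e1 ?e2 ?e3 ?e4 ?mul0r ?mulr0.
Qed.

End Bounds.
End Cutoff.

(** * The divergence-free test field *)

Section ScalarBounds.
Context {R : realType}.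

Lemma norm_sum3_le (F : 'I_3 -> R) (B : R) : (forall i, `|F i| <= B) ->
  `|\sum_(i < 3) F i| <= 3 * B.
Proof.
move=> FB; apply: le_trans (ler_norm_sum _ _ _) _.
by rewrite sum3; have := FB o0; have := FB o1; have := FB o2; lra.
Qed.

Lemma norm_sum33_le (F : 'I_3 -> 'I_3 -> R) (B : R) : (forall i j, `|F i j| <= B) ->
  `|\sum_(i < 3) \sum_(j < 3) F i j| <= 9 * B.
Proof.
move=> FB; rewrite (_ : 9 * B = 3 * (3 * B)); last by ring.
by apply: norm_sum3_le => i; exact: norm_sum3_le.
Qed.

Lemma norm_prod_le (k Q a X Y : R) : `|a| <= k -> X ^+ 2 <= Q -> Y ^+ 2 <= Q ->
  `|a * X * Y| <= k * Q.
Proof.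
move=> ak XQ YQ; rewrite -mulrA normrM; apply: ler_pM => //.
have := sqr_ge0 (X - Y); have := sqr_ge0 (X + Y).
by rewrite ler_norml; lra.
Qed.

(** Young's inequality with a free parameter d. *)
Lemma norm_young_le (k d a X Y W : R) : 0 < d -> `|a| <= k -> Y ^+ 2 <= W ->
  `|a * X * Y| <= k * ((d * X ^+ 2 + d^-1 * W) / 2).
Proof.
move=> d0 ak YW; rewrite -mulrA normrM; apply: ler_pM => //.
have h : 2 * `|X * Y| <= d * X ^+ 2 + d^-1 * Y ^+ 2.
  have p : 0 <= d^-1 * (d * `|X| - `|Y|) ^+ 2.
    by rewrite mulr_ge0 ?sqr_ge0 // invr_ge0 ltW.
  have e : d^-1 * (d * `|X| - `|Y|) ^+ 2
     = d * `|X| ^+ 2 + d^-1 * `|Y| ^+ 2 - 2 * (`|X| * `|Y|).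
    by field; rewrite gt_eqF.
  by move: p; rewrite e !real_normK ?num_real // normrM; lra.
have := ler_wpM2l (_ : 0 <= d^-1) YW; rewrite invr_ge0 (ltW d0) => /(_ isT); lra.
Qed.

Lemma energy_error_le (u : 'I_3 -> R -> R -> R -> R) du dphi z dz (x y t b1 b2 b3 b4 : R) :
  (forall i j, `|dphi j x y t * u i x y t * du j i x y t| <= b1) ->
  (forall i j, `|dz j i x y t * du j i x y t| <= b2) ->
  (forall i j, `|z i x y t * (u j x y t * du j i x y t)| <= b3) ->
  (forall i j, `|dphi j x y t * u j x y t * u i x y t ^+ 2| <= b4) ->
  `|energy_error u du dphi z dz x y t| <= 9 * (b1 + b2 + b3 + b4 / 2).
Proof.
move=> /norm_sum33_le; set S1 := \sum_(i < 3) _ => h1.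
move=> /norm_sum33_le; set S2 := \sum_(i < 3) _ => h2.
move=> /norm_sum33_le; set S3 := \sum_(i < 3) _ => h3.
move=> /norm_sum33_le; set S4 := \sum_(i < 3) _ => h4.
rewrite /energy_error -/S1 -/S2 -/S3 -/S4.
move: h1 h2 h3 h4; rewrite !ler_norml; lra.
Qed.

End ScalarBounds.

Section TestField.
Context {R : realType}.
Notation field := (R -> R -> R -> R).
Context {u : 'I_3 -> field} {du ddu : 'I_3 -> 'I_3 -> field} {p : field} {dp : 'I_3 -> field}.
Context (fl : flow u du ddu p dp).

Let cu : forall i, cfield (u i). Proof. exact: flow_cu fl. Qed.
Let cdu : forall j i, cfield (du j i). Proof. exact: flow_cdu fl. Qed.
Arguments cu : clear implicits.
Arguments cdu : clear implicits.

Definition flux (i : 'I_3) (x y : R) := oint 0 1 (u i x y).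
Definition dflux (j i : 'I_3) (x y : R) := oint 0 1 (du j i x y).

Lemma cplane_flux i : cplane (flux i).
Proof. exact/cont_oint_t/cu. Qed.

Lemma cplane_dflux j i : cplane (dflux j i).
Proof. exact/cont_oint_t/cdu. Qed.

Lemma is_derive_flux_x i x y : is_derive x (1 : R) (flux i ^~ y) (dflux o0 i x y).
Proof.
have := @pd_height_mean R o0 _ _ isT (cu i) (cdu o0 i) (flow_du fl o0 i).
by rewrite /pd /= => /(_ x y 0).
Qed.

Lemma is_derive_flux_y i x y : is_derive y (1 : R) (flux i x) (dflux o1 i x y).
Proof.
have := @pd_height_mean R o1 _ _ isT (cu i) (cdu o1 i) (flow_du fl o1 i).
by rewrite /pd /= => /(_ x y 0).
Qed.

(** The no-slip condition at the lower plane. *)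
Lemma oint_du2 i x y t : 0 <= t <= 1 -> oint 0 t (du o2 i x y) = u i x y t.
Proof.
move=> /andP[t0 t1]; have cuxy := @cfield_t _ _ (cu i) x y.
have cw : {within `[0, t], continuous (u i x y)} by exact: continuous_subspaceT.
have d s : 0 < s < t -> is_derive s 1 (u i x y) (du o2 i x y s).
  by move=> /andP[s0 st]; apply: (flow_du fl o2 i); rewrite s0 (lt_le_trans st).
rewrite (oint_FTC_oo (@cfield_t _ _ (cdu o2 i) x y) t0 cw d).
by have [-> _] := flow_noslip fl i x y; rewrite subr0.
Qed.

(** The vertically averaged flow is divergence-free: the integral of the vertical
derivative of u_3 is the difference of its values on the two planes. *)
Lemma div_flux x y : dflux o1 o1 x y = - dflux o0 o0 x y.
Proof.
have c j := @cfield_t _ _ (cdu j j) x y.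
apply/eqP; rewrite -addr_eq0 /dflux addrC -ointD //.
have -> : oint 0 1 (fun t => du o0 o0 x y t + du o1 o1 x y t)
    = oint 0 1 (fun t => - du o2 o2 x y t).
  apply: eq_oint => //; [by cont|by cont|].
  by move=> t t01; have := flow_div fl x y t01; rewrite sum3; lra.
have -> : (fun t => - du o2 o2 x y t) = fun t => -1 * du o2 o2 x y t.
  by apply/funext => t; rewrite mulN1r.
rewrite ointZ // oint_du2; last by rewrite ler01 lexx.
by have [_ ->] := flow_noslip fl o2 x y; rewrite mulr0.
Qed.

Definition mean_energy : field := height_mean (energy du).

Lemma cfield_energy : cfield (energy du).
Proof. by have := cdu => H; rewrite /energy; cfield. Qed.

Lemma cfield_mean_energy : cfield mean_energy.
Proof. exact/cfield_height_mean/cfield_energy. Qed.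

Lemma energy_ge0 x y t : 0 <= energy du x y t.
Proof. by apply: sumr_ge0 => i _; apply: sumr_ge0 => j _; exact: sqr_ge0. Qed.

Lemma mean_energy_ge0 x y t : 0 <= mean_energy x y t.
Proof.
by apply: oint_ge0 => // [|s _]; [exact/cfield_t/cfield_energy|exact: energy_ge0].
Qed.

Lemma sqr_du_le j i x y t : du j i x y t ^+ 2 <= energy du x y t.
Proof.
rewrite /energy (bigD1 i) //= (bigD1 j) //= -addrA lerDl addr_ge0 //.
  by apply: sumr_ge0 => k _; exact: sqr_ge0.
by apply: sumr_ge0 => k _; apply: sumr_ge0 => m _; exact: sqr_ge0.
Qed.

Lemma height_mean_sqr_du_le j i x y t :
  height_mean (fun x y t => du j i x y t ^+ 2) x y t <= mean_energy x y t.
Proof.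
apply: le_height_mean; [exact/cfieldX/cdu|exact: cfield_energy|].
by move=> s _; exact: sqr_du_le.
Qed.

(** Poincaré inequality in the vertical direction. *)
Lemma sqr_u_le i x y t : 0 <= t <= 1 -> u i x y t ^+ 2 <= mean_energy x y t.
Proof.
move=> t01; rewrite -oint_du2 //; apply: le_trans (height_mean_sqr_du_le o2 i x y t).
by apply: sqr_oint_height_mean => //; rewrite lexx ler01.
Qed.

Lemma height_mean_sqr_u_le i x y t :
  height_mean (fun x y t => u i x y t ^+ 2) x y t <= mean_energy x y t.
Proof.
rewrite -[leRHS]mulr1 -[X in _ * X](subr0 1) -oint_cst /height_mean.
apply: le_oint => //; [|exact: contC|].
  by apply: contX; exact: (@cfield_t _ _ (cu i) x y).
by move=> s s01; exact: (sqr_u_le i x y s01).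
Qed.

Lemma sqr_flux_le i x y t : flux i x y ^+ 2 <= mean_energy x y t.
Proof.
apply: le_trans (height_mean_sqr_u_le i x y t).
by apply: sqr_oint_height_mean => //; rewrite lexx ler01.
Qed.

Section Corrector.
Context (psi : R -> R -> R) (cpsi : cplane psi).
Context (dpsix : forall x y, is_derive x (1 : R) (psi ^~ y) (flux o1 x y)).
Context (dpsiy : forall x y, is_derive y (1 : R) (psi x) (- flux o0 x y)).

(** A vector potential of u that vanishes on both planes: the vertical primitive
(int_0^t u_2, - int_0^t u_1, 0) minus the gradient of [ramp t * psi x y]. *)
Definition potential (i : 'I_3) : field := fun x y t => match val i with
  | 0%N => gauge (u o1) x y t
  | 1%N => - gauge (u o0) x y t
  | _ => - (bell t * psi x y) end.

Definition dpotential (j i : 'I_3) : field := fun x y t => match val i, val j with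
  | 0%N, 0%N | 0%N, 1%N => gauge (du j o1) x y t
  | 0%N, _ => u o1 x y t - bell t * flux o1 x y
  | 1%N, 0%N | 1%N, 1%N => - gauge (du j o0) x y t
  | 1%N, _ => - (u o0 x y t - bell t * flux o0 x y)
  | _, 0%N => - (bell t * flux o1 x y)
  | _, 1%N => bell t * flux o0 x y
  | _, _ => - (dbell t * psi x y) end.

Lemma cfield_bell : cfield (fun _ _ t => bell t : R).
Proof. exact/cfield_z/cont_bell. Qed.

Lemma cfield_potential i : cfield (potential i).
Proof.
have g k := cfield_gauge (cu k).
elim/ord3_ind: i; rewrite /potential /=; [exact: g|exact/cfieldN/g|].
by apply: cfieldN; apply: cfieldM; [exact: cfield_bell|exact: cfield_xy].
Qed.

Lemma cfield_dpotential j i : cfield (dpotential j i).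
Proof.
have g k m := cfield_gauge (cdu k m).
have bf k : cfield (fun x y t => bell t * flux k x y).
  by apply: cfieldM; [exact: cfield_bell|exact/cfield_xy/cplane_flux].
have uf k : cfield (fun x y t => u k x y t - bell t * flux k x y).
  by apply: cfieldD; [exact: cu|exact: cfieldN].
elim/ord3_ind: j; elim/ord3_ind: i; rewrite /dpotential /=;
  try exact: g; try exact: bf; try exact: uf; apply: cfieldN => //.
by apply: cfieldM; [exact/cfield_z/cont_dbell|exact: cfield_xy].
Qed.

Lemma pd_potential j i : pd j (potential i) (dpotential j i).
Proof.
have hx (k m : 'I_3) : k != o2 -> pd k (gauge (u m)) (gauge (du k m)).
  by move=> k2; apply: pd_gauge => //; exact: flow_du fl k m.
have h2 k := pd_gauge2 (cu k).
have hpsi k := pdN (pdM (pdt k (@is_derive_bell R)) (pdxy k dpsix dpsiy)).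
elim/ord3_ind: i; rewrite /potential /=.
- by elim/ord3_ind: j; rewrite /dpotential /=; [exact: hx|exact: hx|exact: h2].
- by elim/ord3_ind: j; rewrite /dpotential /=; apply: pdN; [exact: hx|exact: hx|exact: h2].
- apply: pd_ext (hpsi j) _ => x y t.
  by elim/ord3_ind: j; rewrite /dpotential /=; ring.
Qed.

Context (L : R) (L1 : 1 <= L).
Let l := L^-1.
Let f := dcutoff l.
Let ff := ddcutoff l.

(** The cross product of the gradient of the cutoff with [potential], so that
phi u plus the corrector is the curl of phi times the potential. *)
Definition corrector (i : 'I_3) : field := fun x y t => match val i with
  | 0%N => f o1 x y t * potential o2 x y t
  | 1%N => - (f o0 x y t * potential o2 x y t)
  | _ => f o0 x y t * potential o1 x y t - f o1 x y t * potential o0 x y t end.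

Definition dcorrector (j i : 'I_3) : field := fun x y t => match val i with
  | 0%N => ff j o1 x y t * potential o2 x y t + f o1 x y t * dpotential j o2 x y t
  | 1%N => - (ff j o0 x y t * potential o2 x y t + f o0 x y t * dpotential j o2 x y t)
  | _ => (ff j o0 x y t * potential o1 x y t + f o0 x y t * dpotential j o1 x y t)
       - (ff j o1 x y t * potential o0 x y t + f o1 x y t * dpotential j o0 x y t) end.

Lemma cfield_corrector i : cfield (corrector i).
Proof.
have h k m : cfield (fun x y t => f k x y t * potential m x y t).
  by apply: cfieldM; [exact: cfield_dcutoff|exact: cfield_potential].
elim/ord3_ind: i; rewrite /corrector /=; [exact: h|exact/cfieldN/h|].
by apply: cfieldD; [exact: h|exact/cfieldN/h].
Qed.

Lemma cfield_dcorrector j i : cfield (dcorrector j i).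
Proof.
have h k m : cfield (fun x y t => ff j k x y t * potential m x y t
    + f k x y t * dpotential j m x y t).
  apply: cfieldD; apply: cfieldM; [exact: cfield_ddcutoff|exact: cfield_potential
    |exact: cfield_dcutoff|exact: cfield_dpotential].
elim/ord3_ind: i; rewrite /dcorrector /=; [exact: h|exact/cfieldN/h|].
by apply: cfieldD; [exact: h|exact/cfieldN/h].
Qed.

Lemma pd_corrector j i : pd j (corrector i) (dcorrector j i).
Proof.
have h k m := pdM (pd_dcutoff l j k) (pd_potential j m).
by elim/ord3_ind: i; rewrite /corrector /dcorrector /=;
  [exact: h|apply: pdN; exact: h|apply: pdD; [|apply: pdN]; exact: h].
Qed.

Lemma face_corrector j i : zero_on_faces j L (corrector i).
Proof.
have h k m : zero_on_faces j L (fun x y t => f k x y t * potential m x y t).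
  elim/ord3_ind: j.
  - by apply: zero_on_facesMl; exact: dcutoff_faces.
  - by apply: zero_on_facesMl; exact: dcutoff_faces.
  - apply: zero_on_facesMr; elim/ord3_ind: m; rewrite /zero_on_faces /potential /= => x y.
    + by rewrite gauge0 gauge1.
    + by rewrite gauge0 gauge1 oppr0.
    + by rewrite /bell subrr !mulr0 !mul0r oppr0.
elim/ord3_ind: i; rewrite /corrector /=; [exact: h|exact/zero_on_facesN/h|].
by apply: zero_on_facesD; [exact: h|exact/zero_on_facesN/h].
Qed.

(** The divergence of grad phi x A is - grad phi . curl A, where curl A = u. *)
Lemma div_corrector x y t :
  \sum_(j < 3) dcorrector j j x y t = - \sum_(j < 3) f j x y t * u j x y t.
Proof.
rewrite !sum3 /dcorrector /ff /f /dpotential /ddcutoff /dcutoff /=; ring.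
Qed.

End Corrector.
End TestField.

(** * The energy estimate *)

Section Pointwise.
Context {R : realType}.
Notation field := (R -> R -> R -> R).
Context {u : 'I_3 -> field} {du ddu : 'I_3 -> 'I_3 -> field} {p : field} {dp : 'I_3 -> field}.
Context (fl : flow u du ddu p dp).
Context (M : R) (uM : forall i (x y t : R), 0 <= t <= 1 -> `|u i x y t| <= M).
Context (psi : R -> R -> R) (L : R) (L1 : 1 <= L) (d : R) (d0 : 0 < d).
Let l := L^-1.

(** Dominates the squares of psi / L, of u and its derivatives, of its vertical
averages and of its gauges; its integral is at most 25 times the energy. *)
Definition total_sqr : field := fun x y t =>
  (psi x y * l) ^+ 2 + 8 * mean_energy (du := du) x y t + energy du x y t.

(** Controls the critical products, those of a derivative of phi with psi, by
[norm_young_le] applied to psi / L and to L grad phi . grad u. *)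
Definition young_weight : field := fun x y t =>
  (d * (psi x y * l) ^+ 2
   + d^-1 * (16 * ((x * l) ^+ 2 + (y * l) ^+ 2) * energy du x y t)) / 2.

(** Each product in [energy_error] is one of two kinds.  Either its coefficient is at
most 24/L times a power of M, and its two other factors have squares bounded by
[total_sqr]; or it is critical, and is bounded by [young_weight].  A critical
product arises where the potential component - [bell] psi is not differentiated
horizontally and is multiplied by a first derivative of phi. *)
Lemma energy_error_bound (x y t : R) : - L <= x <= L -> - L <= y <= L -> 0 <= t <= 1 ->
  `|energy_error u du (dcutoff l) (corrector (u := u) psi L)
      (dcorrector (u := u) (du := du) psi L) x y t|
    <= 45 * (1 + M) * (24 * l) * total_sqr x y t + 54 * (1 + M) * young_weight x y t.
Proof.
move=> xL yL t01.
have L0 : 0 < L by apply: lt_le_trans L1.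
have l0 : 0 < l by rewrite invr_gt0.
have l1 : l <= 1 by rewrite invf_le1.
have lL : l * L = 1 by rewrite mulVf // gt_eqF.
have M0 : 0 <= M by apply: le_trans (uM o0 x y t01).
have me0 := mean_energy_ge0 fl x y t.
have e0 := energy_ge0 (du := du) x y t.
have psi2 := sqr_ge0 (psi x y * l).
set Q := total_sqr x y t; set W := young_weight x y t.
have EQ : Q = (psi x y * l) ^+ 2 + 8 * mean_energy (du := du) x y t + energy du x y t by [].
have Q0 : 0 <= Q by rewrite EQ; lra.
have rho0 : 0 <= (x * l) ^+ 2 + (y * l) ^+ 2 by rewrite addr_ge0 ?sqr_ge0.
have W0 : 0 <= W.
  rewrite /W /young_weight divr_ge0 // addr_ge0 //; first by rewrite mulr_ge0 // ltW.
  by rewrite mulr_ge0 ?invr_ge0 ?(ltW d0) // !mulr_ge0.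
pose k := 24 * l.
have k0 : 0 <= k by rewrite /k mulr_ge0 // ltW.
have [h0 h1] : 0 <= bell t /\ bell t <= 3 / 2.
  rewrite /bell; split; first by rewrite !mulr_ge0 //; lra.
  by have := sqr_ge0 (t - 1 / 2); lra.
have hb : `|bell t| <= 3 / 2 by rewrite ger0_norm.
have hdb : `|dbell t| <= 6 by rewrite /dbell ler_norml; lra.
have psiQ : (psi x y * l) ^+ 2 <= Q by rewrite EQ; lra.
have DQ j i : du j i x y t ^+ 2 <= Q by rewrite EQ; have := sqr_du_le (du := du) j i x y t; lra.
have uQ i : u i x y t ^+ 2 <= Q by rewrite EQ; have := sqr_u_le fl i x y t01; lra.
have VQ i : flux (u := u) i x y ^+ 2 <= Q by rewrite EQ; have := sqr_flux_le fl i x y t; lra.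
have gQ i : gauge (u i) x y t ^+ 2 <= Q.
  rewrite EQ; have := sqr_gauge_le x y (flow_cu fl (i := i)) t01.
  have := height_mean_sqr_u_le fl i x y t; lra.
have dgQ j i : gauge (du j i) x y t ^+ 2 <= Q.
  rewrite EQ; have := sqr_gauge_le x y (flow_cdu fl (j := j) (i := i)) t01.
  have := height_mean_sqr_du_le fl j i x y t; lra.
have uVQ i : (u i x y t - bell t * flux (u := u) i x y) ^+ 2 <= Q.
  have h2 : bell t ^+ 2 <= 9 / 4.
    have -> : 9 / 4 = (3 / 2) ^+ 2 :> R by field.
    by rewrite ler_sqr ?nnegrE //; lra.
  have hV : (bell t * flux (u := u) i x y) ^+ 2 <= 9 / 4 * mean_energy (du := du) x y t.
    rewrite exprMn; apply: ler_pM => //; first exact: sqr_ge0.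
    exact: sqr_ge0. exact: (sqr_flux_le fl i x y t).
  have := sqr_u_le fl i x y t01.
  have := sqr_ge0 (u i x y t + bell t * flux (u := u) i x y).
  by rewrite EQ; lra.
have A0Q : potential (u := u) psi o0 x y t ^+ 2 <= Q by exact: gQ.
have A1Q : potential (u := u) psi o1 x y t ^+ 2 <= Q by rewrite /potential /= sqrrN; exact: gQ.
have dA0Q j : dpotential (u := u) (du := du) psi j o0 x y t ^+ 2 <= Q.
  by elim/ord3_ind: j; rewrite /dpotential /=; [exact: dgQ|exact: dgQ|exact: uVQ].
have dA1Q j : dpotential (u := u) (du := du) psi j o1 x y t ^+ 2 <= Q.
  by elim/ord3_ind: j; rewrite /dpotential /= sqrrN; [exact: dgQ|exact: dgQ|exact: uVQ].
have fk j : `|dcutoff l j x y t| <= k.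
  by apply: le_trans (dcutoff_bound L1 j t xL yL) _; rewrite -/l /k; lra.
have ffk j m : `|ddcutoff l j m x y t| <= k.
  apply: le_trans (ddcutoff_bound L1 j m t xL yL) _; rewrite -/l /k.
  have : l ^+ 2 <= l by rewrite expr2 ler_piMl // ltW.
  lra.
have fhk j (s : R) : `|s| <= 3 / 2 -> `|dcutoff l j x y t * s| <= k.
  move=> hs; rewrite normrM (_ : k = 4 * l * 6); last by rewrite /k; ring.
  by apply: ler_pM => //; [exact: (dcutoff_bound L1 j t xL yL)|lra].
have ffhk j m (s : R) : `|s| <= 3 / 2 -> `|ddcutoff l j m x y t * L * s| <= k.
  move=> hs; rewrite normrM (_ : k = 16 * l * (3 / 2)); last by rewrite /k; field.
  apply: ler_pM => //; rewrite normrM (gtr0_norm L0).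
  rewrite (_ : 16 * l = 16 * l ^+ 2 * L); last by rewrite -[LHS]mulr1 -lL; ring.
  by rewrite ler_pM2r //; exact: (ddcutoff_bound L1 j m t xL yL).
have fLe m j i : (dcutoff l m x y t * L * du j i x y t) ^+ 2
    <= 16 * ((x * l) ^+ 2 + (y * l) ^+ 2) * energy du x y t.
  rewrite exprMn; apply: ler_pM; rewrite ?sqr_ge0 //.
    exact: (sqr_dcutoff_bound L1 m t xL yL).
  exact: sqr_du_le.
(* critical products: move one factor L from psi to the derivative of phi *)
have crit m j i (c s : R) : `|s| <= c ->
    `|dcutoff l m x y t * (s * psi x y) * du j i x y t| <= c * W.
  move=> sc; rewrite (_ : dcutoff l m x y t * (s * psi x y) * du j i x y t
    = s * (psi x y * l) * (dcutoff l m x y t * L * du j i x y t)).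
    exact: norm_young_le d0 sc (fLe m j i).
  by rewrite -[LHS]mulr1 -lL; ring.
have b1 i j : `|dcutoff l j x y t * u i x y t * du j i x y t| <= k * Q.
  exact: norm_prod_le.
have b2h m j i : j != o2 -> `|(ddcutoff l j m x y t * potential (u := u) psi o2 x y t
    + dcutoff l m x y t * dpotential (u := u) (du := du) psi j o2 x y t) * du j i x y t|
    <= 2 * (k * Q).
  move=> j2; rewrite mulrDl (_ : 2 * (k * Q) = k * Q + k * Q); last by ring.
  apply: le_trans (ler_normD _ _) _; apply: lerD.
    rewrite /potential /= (_ : _ * _ * _
      = ddcutoff l j m x y t * L * (- bell t) * (psi x y * l) * du j i x y t).
      by apply: norm_prod_le => //; apply: ffhk; rewrite normrN.
    by rewrite -[LHS]mulr1 -lL; ring.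
  elim/ord3_ind: j j2 => // _; rewrite /dpotential /=.
    rewrite -mulNr (mulrA (dcutoff l m x y t)); apply: norm_prod_le => //.
    by apply: fhk; rewrite normrN.
  by rewrite (mulrA (dcutoff l m x y t)); apply: norm_prod_le => //; exact: fhk.
have b2v m i : `|(ddcutoff l o2 m x y t * potential (u := u) psi o2 x y t
    + dcutoff l m x y t * dpotential (u := u) (du := du) psi o2 o2 x y t) * du o2 i x y t| <= 6 * W.
  have -> : ddcutoff l o2 m x y t = 0 by elim/ord3_ind: m.
  rewrite mul0r add0r /dpotential /= -mulNr; apply: crit; by rewrite normrN.
have kQ0 : 0 <= k * Q by exact: mulr_ge0.
have b2hv m j i : `|(ddcutoff l j m x y t * potential (u := u) psi o2 x y t
    + dcutoff l m x y t * dpotential (u := u) (du := du) psi j o2 x y t) * du j i x y t|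
    <= 4 * (k * Q) + 6 * W.
  have [->|j2] := eqVneq j o2; first by apply: le_trans (b2v m i) _; lra.
  by apply: le_trans (b2h m j i j2) _; lra.
have b2 i j : `|dcorrector (u := u) (du := du) psi L j i x y t * du j i x y t|
    <= 4 * (k * Q) + 6 * W.
  elim/ord3_ind: i; rewrite /dcorrector /= -/l.
  - exact: b2hv.
  - by rewrite mulNr normrN; exact: b2hv.
  - have T (a X : R) : `|a| <= k -> X ^+ 2 <= Q -> `|a * X * du j o2 x y t| <= k * Q.
      by move=> ak XQ; exact: norm_prod_le.
    have t1 := T _ _ (ffk j o0) A1Q; have t2 := T _ _ (fk o0) (dA1Q j).
    have t3 := T _ _ (ffk j o1) A0Q; have t4 := T _ _ (fk o1) (dA0Q j).
    rewrite mulrBl !mulrDl; move: t1 t2 t3 t4; rewrite !ler_norml; lra.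
have b3 i j : `|corrector (u := u) psi L i x y t * (u j x y t * du j i x y t)|
    <= M * (2 * (k * Q) + 2 * W).
  rewrite mulrCA normrM; apply: ler_pM => //; first exact: uM.
  elim/ord3_ind: i; rewrite /corrector /= -/l.
  - rewrite {1}/potential /= -mulNr; apply: (@le_trans _ _ (3 / 2 * W)); last by lra.
    by apply: crit; rewrite normrN.
  - rewrite {1}/potential /= mulNr normrN.
    apply: (@le_trans _ _ (3 / 2 * W)); last by lra.
    by rewrite -mulNr; apply: crit; rewrite normrN.
  - have t1 := norm_prod_le (fk o0) A1Q (DQ j o2).
    have t2 := norm_prod_le (fk o1) A0Q (DQ j o2).
    by rewrite mulrBl; move: t1 t2; rewrite !ler_norml; lra.
have b4 i j : `|dcutoff l j x y t * u j x y t * u i x y t ^+ 2| <= M * (k * Q).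
  rewrite (_ : _ * _ ^+ 2 = u j x y t * (dcutoff l j x y t * u i x y t * u i x y t)); last by ring.
  by rewrite normrM; apply: ler_pM => //; [exact: uM|exact: norm_prod_le].
apply: le_trans (energy_error_le b1 b2 b3 b4) _; rewrite -/k.
have := mulr_ge0 M0 kQ0; have := mulr_ge0 M0 W0; lra.
Qed.

End Pointwise.

Section MainEstimate.
Context {R : realType}.
Notation field := (R -> R -> R -> R).
Context {u : 'I_3 -> field} {du ddu : 'I_3 -> 'I_3 -> field} {p : field} {dp : 'I_3 -> field}.
Context (fl : flow u du ddu p dp).

(** The squares of the two components of the averaged flow are bounded by the
vertical mean of the energy, hence the factor 16 = 2 * 8. *)
Lemma flow_stream_function (L : R) : 0 < L ->
  exists psi : R -> R -> R, [/\ cplane psi,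
    (forall x y, is_derive x (1 : R) (psi ^~ y) (flux (u := u) o1 x y)),
    (forall x y, is_derive y (1 : R) (psi x) (- flux (u := u) o0 x y)) &
    boxint L (fun x y _ => (psi x y * L^-1) ^+ 2) <= 16 * boxint L (energy du)].
Proof.
move=> L0; have dW x y : is_derive y (1 : R) (flux (u := u) o1 x) (- dflux (du := du) o0 o0 x y).
  by rewrite -(div_flux fl); exact: is_derive_flux_y fl o1 x y.
have [psi [cpsi dx dy bnd]] := stream_function L0 (cplane_flux fl (i := o0))
  (cplane_flux fl (i := o1)) (cplane_dflux fl (j := o0) (i := o0)) (is_derive_flux_x fl o0) dW.
exists psi; split => //.
have const2 (V : R -> R -> R) : oint (- L) L (fun x => oint (- L) L (fun y => V x y ^+ 2))
    = boxint L (fun x y _ => V x y ^+ 2).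
  rewrite /boxint; congr oint; apply/funext => x; congr oint; apply/funext => y.
  by rewrite oint_cst subr0 mulr1.
have fluxE i : boxint L (fun x y _ => flux (u := u) i x y ^+ 2) <= boxint L (energy du).
  rewrite -(boxint_height_mean L (energy du)); apply: le_boxint; first exact: ltW.
  - by apply: cfieldX; apply: cfield_xy; exact: cplane_flux fl i.
  - exact: cfield_mean_energy fl.
  - by move=> x y t _ _ _; exact: (sqr_flux_le fl i x y t).
have cp2 : cfield (fun x y _ => psi x y ^+ 2) by apply: cfieldX; exact: cfield_xy.
have -> : (fun x y _ => (psi x y * L^-1) ^+ 2) = fun x y (t : R) => L^-1 ^+ 2 * psi x y ^+ 2.
  by do 3!apply/funext => ?; ring.
rewrite boxintZ // -const2; move: bnd; rewrite !const2 => bnd.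
have l2 : 0 <= L^-1 ^+ 2 by exact: sqr_ge0.
apply: le_trans (ler_wpM2l l2 bnd) _.
have e (X : R) : L^-1 ^+ 2 * (8 * L ^+ 2 * X) = 8 * X by field; rewrite gt_eqF.
by rewrite e; have := fluxE o0; have := fluxE o1; lra.
Qed.

(** Integration of [energy_error_bound] over the box; the part of [young_weight]
that carries 1/d is an energy weighted by (x^2 + y^2)/L^2, which [cutoff_weight]
turns into twice the energy missed by the cutoff. *)
Lemma energy_estimate (M : R) :
  (forall i (x y t : R), 0 <= t <= 1 -> `|u i x y t| <= M) ->
  exists2 K : R, 0 < K & forall L d : R, 1 <= L -> 0 < d ->
  boxint L (fun x y t => cutoff L^-1 x y t * energy du x y t) <=
  K * (L^-1 + d) * boxint L (energy du) + K * d^-1 * (boxint L (energy du)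
    - boxint L (fun x y t => cutoff L^-1 x y t * energy du x y t)).
Proof.
move=> uM.
have M0 : 0 <= M by apply: le_trans (uM o0 0 0 0 _); rewrite ?lexx ?ler01.
(* 45 * 24 from the bound of the regular products, 25 from the integral of [total_sqr] *)
exists (45 * 24 * 25 * (1 + M)); first by rewrite mulr_gt0 //; lra.
move=> L d L1 d0.
have L0 : 0 < L by apply: lt_le_trans L1.
have L0' := ltW L0.
have l0 : 0 < L^-1 by rewrite invr_gt0.
have di0 : 0 < d^-1 by rewrite invr_gt0.
have [psi [cpsi dx dy psiE]] := flow_stream_function L0.
have [f0 f1] := cutoff_faces L1.
have id := energy_identity fl L0' (@cfield_cutoff R L^-1) (@cfield_dcutoff R L^-1)
  (fun j => pd_cutoff L^-1 j) (@cfield_corrector _ _ _ _ _ _ fl psi cpsi L)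
  (@cfield_dcorrector _ _ _ _ _ _ fl psi cpsi L) (pd_corrector fl dx dy L) f0 f1
  (fun j i => face_corrector (u := u) psi L1 j i)
  (fun x y t _ => div_corrector (u := u) (du := du) psi L x y t).
set E := boxint L (energy du) in psiE *.
set F := boxint L (fun x y t => cutoff _ x y t * _) in id *.
have ce := cfield_energy fl.
have cm := cfield_mean_energy fl.
have cp0 : cfield (fun x y (_ : R) => psi x y) by exact: cfield_xy.
have cx : cfield (fun x (_ _ : R) => x) by apply: cfield_x; cont.
have cy : cfield (fun (_ : R) y (_ : R) => y) by apply: cfield_y; cont.
have cp : cfield (fun x y (_ : R) => (psi x y * L^-1) ^+ 2).
  by cfield.
have cre : cfield (fun x y t => ((x * L^-1) ^+ 2 + (y * L^-1) ^+ 2) * energy du x y t).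
  by cfield.
pose a := 45 * (1 + M) * (24 * L^-1); pose b := 54 * (1 + M).
have a0 : 0 <= a by rewrite !mulr_ge0 //; lra.
have b0 : 0 <= b by rewrite mulr_ge0 //; lra.
have cerr : cfield (energy_error u du (dcutoff L^-1) (corrector (u := u) psi L)
    (dcorrector (u := u) (du := du) psi L)).
  have c1 := @cfield_dcutoff R L^-1; have c2 := @flow_cu _ _ _ _ _ _ fl.
  have c3 := @flow_cdu _ _ _ _ _ _ fl; have c4 := @cfield_corrector _ _ _ _ _ _ fl psi cpsi L.
  have c5 := @cfield_dcorrector _ _ _ _ _ _ fl psi cpsi L.
  by rewrite /energy_error; cfield.
have weight : boxint L (fun x y t => ((x * L^-1) ^+ 2 + (y * L^-1) ^+ 2) * energy du x y t)
    <= 2 * (E - F).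
  have c1 := @cfield_cutoff R L^-1.
  have cF : cfield (fun x y t => cutoff L^-1 x y t * energy du x y t) by exact: cfieldM.
  have -> : 2 * (E - F) = boxint L (fun x y t =>
      2 * (energy du x y t + - (cutoff L^-1 x y t * energy du x y t))).
    rewrite boxintZ; last by apply: cfieldD => //; exact: cfieldN.
    by rewrite boxintD ?boxintN //; exact: cfieldN.
  apply: le_boxint => //; first by cfield.
  move=> x y t xL yL _; have := cutoff_weight L1 t xL yL.
  by move/(ler_wpM2r (energy_ge0 (du := du) x y t)); lra.
have bound : F <= (a + b * d / 2) * (16 * E) + (8 * a * E + (a * E
    + 8 * b * d^-1 * (2 * (E - F)))).
  apply: (@le_trans _ _ (boxint L (fun x y t =>
      (a + b * d / 2) * (psi x y * L^-1) ^+ 2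
      + (8 * a * mean_energy (du := du) x y t + (a * energy du x y t
      + 8 * b * d^-1 * (((x * L^-1) ^+ 2 + (y * L^-1) ^+ 2) * energy du x y t)))))).
    rewrite id -boxintN //; apply: le_boxint => //; [by cfield|by cfield|].
    move=> x y t xL yL t01; have := energy_error_bound fl uM psi L1 d0 xL yL t01.
    rewrite ler_norml => /andP[h _]; rewrite lerNl; apply: le_trans h.
    rewrite lerN2 /total_sqr /young_weight -/a -/b le_eqVlt; apply/orP; left; apply/eqP.
    by field; rewrite !gt_eqF.
  have c1 (k : R) (f : field) : cfield f -> cfield (fun x y t => k * f x y t).
    by move=> cf; cfield.
  rewrite (boxintD _ (c1 _ _ cp)); last by cfield.
  rewrite (boxintD _ (c1 _ _ cm)); last by cfield.
  rewrite (boxintD _ (c1 _ _ ce) (c1 _ _ cre)) !boxintZ //.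
  rewrite (_ : boxint L mean_energy = E); last exact: boxint_height_mean.
  apply: lerD.
    apply: ler_wpM2l psiE; apply: addr_ge0 => //; apply: divr_ge0 => //.
    by apply: mulr_ge0 => //; exact: ltW.
  rewrite !lerD2l; apply: ler_wpM2l weight.
  by apply: mulr_ge0; [apply: mulr_ge0|exact: ltW].
have E0 : 0 <= E by apply: boxint_ge0 => // x y t _ _ _; exact: energy_ge0.
have EF : 0 <= E - F.
  rewrite -(pmulr_rge0 (x := 2)) //; apply: le_trans weight.
  apply: boxint_ge0 => // x y t _ _ _.
  by rewrite mulr_ge0 ?energy_ge0 // addr_ge0 ?sqr_ge0.
have p1 : 0 <= (1 + M) * d * E by rewrite !mulr_ge0 //; [lra|exact: ltW].
have p2 : 0 <= (1 + M) * d^-1 * (E - F) by rewrite !mulr_ge0 //; [lra|exact: ltW].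
move: bound p1 p2; rewrite /a /b; set di := d^-1; set li := L^-1.
by clearbody di li E F; lra.
Qed.

End MainEstimate.

(** * Vanishing of the energy *)

Section Liouville.
Context {R : realType}.
Notation field := (R -> R -> R -> R).
Context {u : 'I_3 -> field} {du ddu : 'I_3 -> 'I_3 -> field} {p : field} {dp : 'I_3 -> field}.
Context (fl : flow u du ddu p dp).
Context (M : R) (uM : forall i (x y t : R), 0 <= t <= 1 -> `|u i x y t| <= M).
Context (D0 : R) (ED0 : forall L, 0 <= L -> boxint L (energy du) <= D0).

Let ce := cfield_energy fl.
Let e0 := energy_ge0 (du := du).

(** Bernoulli's inequality for each profile. *)
Lemma cutoff_lower (L m x y t : R) : 1 <= L -> 0 <= m -> m <= L ->
  - m <= x <= m -> - m <= y <= m -> 1 - 4 * (m * L^-1) ^+ 2 <= cutoff L^-1 x y t.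
Proof.
move=> L1 m0 mL xm ym.
have L0 : 0 < L by apply: lt_le_trans L1.
have l0 : 0 <= L^-1 by rewrite invr_ge0 ltW.
have xL : - L <= x <= L by lra.
have yL : - L <= y <= L by lra.
have aux s : - m <= s <= m -> (s * L^-1) ^+ 2 <= (m * L^-1) ^+ 2.
  move=> /andP[s1 s2]; rewrite !exprMn ler_wpM2r ?sqr_ge0 //.
  have : 0 <= (m - s) * (m + s) by apply: mulr_ge0; lra.
  lra.
have hx := aux x xm; have hy := aux y ym.
have ex := profile_bounds L1 xL; have ey := profile_bounds L1 yL.
have lin s : 1 - 2 * (s * L^-1) ^+ 2 <= profile L^-1 s.
  by rewrite /profile; have := sqr_ge0 ((s * L^-1) ^+ 2); lra.
have lx := lin x; have ly := lin y.
have : 0 <= (1 - profile L^-1 x) * (1 - profile L^-1 y) by apply: mulr_ge0; lra.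
rewrite /cutoff; lra.
Qed.

(** With D the supremum of the energies of boxes, take a box of side 2m that misses
less than d^2 of D, and then L so large that phi >= 1 - d^2 on it.  The weighted
energy misses at most d^2 (1 + D) of D, and [energy_estimate] gives D <= C d. *)
Lemma boxint_energy_eq0 L : 0 <= L -> boxint L (energy du) = 0.
Proof.
have [K K0 est] := energy_estimate fl uM.
pose S := [set boxint L (energy du) | L in [set L : R | 0 <= L]].
have supS : has_sup S.
  split; first by exists (boxint 0 (energy du)); exists 0 => //=.
  by exists D0 => _ [L' /= L'0 <-]; exact: ED0.
pose D := sup S.
have ED L' : 0 <= L' -> boxint L' (energy du) <= D.
  by move=> L'0; apply: ub_le_sup; [case: supS|exists L'].
have E0 L' : 0 <= L' -> 0 <= boxint L' (energy du).
  by move=> L'0; apply: boxint_ge0 => // x y t _ _ _; exact: e0.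
have D_ge0 : 0 <= D by apply: le_trans (E0 0 _) (ED 0 _).
pose C := 2 * K * D + (K + 1) * (1 + D).
have C0 : 0 < C.
  by apply: ltr_wpDl; [rewrite !mulr_ge0 // ltW|apply: mulr_gt0; lra].
have small (d : R) : 0 < d -> d <= 1 -> D <= C * d.
  move=> d0 d1.
  have d20 : 0 < d ^+ 2 by rewrite exprn_gt0.
  have [_ [m /= m0 <-] Em] := sup_adherent d20 supS.
  have di0 : 0 < d^-1 by rewrite invr_gt0.
  (* large enough for 1/L' <= d and 4 (m/L')^2 <= d^2 *)
  pose L' := 1 + d^-1 + 2 * m * d^-1.
  have md : 0 <= m * d^-1 by rewrite mulr_ge0 // ltW.
  have d1i : 1 <= d^-1 by rewrite invf_ge1.
  have L1 : 1 <= L' by rewrite /L'; lra.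
  have L0 : 0 < L' by apply: lt_le_trans L1.
  have mL : m <= L'.
    by rewrite /L'; have := ler_wpM2l m0 d1i; rewrite mulr1; lra.
  have ld : L'^-1 <= d.
    by rewrite -[d]invrK lef_pV2 ?posrE // /L'; lra.
  have mld : 4 * (m * L'^-1) ^+ 2 <= d ^+ 2.
    have h : 2 * (m * L'^-1) <= d.
      have dL : d * L' = d + 1 + 2 * m by rewrite /L'; field; rewrite gt_eqF.
      by rewrite mulrA ler_pdivrMr // dL; lra.
    have h0 : 0 <= m * L'^-1 by rewrite mulr_ge0 // invr_ge0 ltW.
    rewrite (_ : 4 * _ ^+ 2 = (2 * (m * L'^-1)) ^+ 2); last by ring.
    by rewrite ler_sqr ?nnegrE //; [lra|exact: ltW].
  set E := boxint L' (energy du).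
  have := est L' d L1 d0; rewrite -/E.
  set F := boxint L' _ => FE.
  have cF : cfield (fun x y t => cutoff L'^-1 x y t * energy du x y t).
    by apply: cfieldM => //; exact: cfield_cutoff.
  have Fm : (1 - d ^+ 2) * boxint m (energy du) <= F.
    apply: (@le_trans _ _ (boxint m (fun x y t => cutoff L'^-1 x y t * energy du x y t))).
      rewrite -boxintZ //; apply: le_boxint => //; first by apply: cfieldM => //; exact: cfieldC.
      move=> x y t xm ym _; apply: ler_wpM2r => //.
      by apply: le_trans (cutoff_lower t L1 m0 mL xm ym); lra.
    apply: boxint_mono => // x y t; apply: mulr_ge0 => //.
    by rewrite /cutoff mulr_ge0 ?sqr_ge0.
  have EmD := ED m m0; have ELD : E <= D by apply: ED; exact: ltW.
  have EL0 : 0 <= E by apply: E0; exact: ltW.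
  have DF : D - F <= d ^+ 2 * (1 + D).
    have := ler_wpM2l (ltW d20) EmD; move: Em Fm; rewrite -/D; lra.
  have h1 : K * (L'^-1 + d) * E <= K * (2 * d) * D.
    apply: ler_pM => //.
      by rewrite mulr_ge0 ?addr_ge0 ?invr_ge0 // ltW.
    by apply: ler_wpM2l; [exact: ltW|lra].
  have h2 : K * d^-1 * (E - F) <= K * d * (1 + D).
    apply: (@le_trans _ _ (K * d^-1 * (d ^+ 2 * (1 + D)))).
      by apply: ler_wpM2l; [rewrite mulr_ge0 // ltW|lra].
    by rewrite le_eqVlt; apply/orP; left; apply/eqP; field; rewrite gt_eqF.
  have h3 : d ^+ 2 * (1 + D) <= d * (1 + D).
    by apply: ler_wpM2r; [lra|rewrite expr2 ler_piMl // ltW].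
  rewrite /C; lra.
have D_le0 : D <= 0.
  rewrite leNgt; apply/negP => D_gt0.
  pose d := Num.min 1 (D / (2 * C)).
  have q0 : 0 < D / (2 * C) by rewrite divr_gt0 // mulr_gt0.
  have d0 : 0 < d by rewrite lt_min ltr01 q0.
  have d1 : d <= 1 by rewrite ge_min lexx.
  have d2 : d <= D / (2 * C) by rewrite ge_min lexx orbT.
  have := small d d0 d1; apply/negP; rewrite -ltNge.
  apply: le_lt_trans (ler_wpM2l (ltW C0) d2) _.
  rewrite (_ : C * (D / (2 * C)) = D / 2); first by lra.
  by field; rewrite gt_eqF.
move=> L0; apply/eqP; rewrite eq_le E0 // andbT.
exact: le_trans (ED _ L0) D_le0.
Qed.

Theorem flow_eq0 i x y t : 0 <= t <= 1 -> u i x y t = 0.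
Proof.
move=> t01.
pose L := `|x| + `|y| + 1.
have nx := normr_ge0 x; have ny := normr_ge0 y.
have L0 : 0 <= L by rewrite /L; lra.
have LL : - L < L by rewrite /L; lra.
have xL : - L <= x <= L by rewrite -ler_norml /L; lra.
have yL : - L <= y <= L by rewrite -ler_norml /L; lra.
have tge0 a b : 0 <= oint 0 1 (energy du a b).
  by apply: oint_ge0 => //; exact: cfield_t.
have Ex : oint (- L) L (fun y => oint 0 1 (energy du x y)) = 0.
  apply: (oint_eq0 (cont_oint_yt ce (L := L)) (ltW LL) _ (boxint_energy_eq0 L0) LL xL).
  by move=> a _; apply: oint_ge0 => //; [exact: cont_oint_t_y|exact: ltW].
have Exy : oint 0 1 (energy du x y) = 0.
  by apply: (oint_eq0 (cont_oint_t_y ce (x := x)) (ltW LL) _ Ex LL yL).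
apply/eqP; rewrite -sqrf_eq0 eq_le sqr_ge0 andbT.
by apply: le_trans (sqr_u_le fl i x y t01) _; rewrite /mean_energy /height_mean Exy.
Qed.

End Liouville.

(** * Comparison with Lebesgue integrals *)

Section Measurability.
Context {R : realType}.

(** The integral of a nonnegative function is a supremum over the simple functions
below it, so monotonicity holds for arbitrary functions; this dispenses with the
measurability of inner integrals. *)
Lemma ge0_le_integral_sub d (T : measurableType d) (mu : {measure set T -> \bar R})
    (A B : set T) (f g : T -> \bar R) :
  (forall x, 0 <= f x)%E -> (forall x, 0 <= g x)%E -> A `<=` B ->
  (forall x, A x -> f x <= g x)%E ->
  (\int[mu]_(x in A) f x <= \int[mu]_(x in B) g x)%E.
Proof.
move=> f0 g0 AB fg; rewrite !(ge0_integralE _ (fun x _ => _)) //.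
apply: le_ereal_sup => _ [h /= hf <-]; exists h => //= x.
apply: le_trans (hf x) _; rewrite !patchE.
case: ifPn => [/set_mem Ax|_]; last by case: ifP.
by rewrite ifT ?inE; [exact: fg|exact: AB].
Qed.

(** Freezing the second variable at the grid point of step 1/(n+1) below it gives
functions that are measurable, being so on countably many horizontal strips, and
that converge to f. *)
Lemma cplane_measurable (f : R -> R -> R) : cplane f ->
  measurable_fun setT (fun z : measurableTypeR R * measurableTypeR R => f z.1 z.2).
Proof.
move=> cf.
pose q (n : nat) (k : int) : R := k%:~R / n.+1%:R.
pose h (n : nat) (z : measurableTypeR R * measurableTypeR R) : R :=
  f z.1 (q n (Num.floor (z.2 * n.+1%:R))).
apply: (measurable_fun_cvg (h := h)).
- move=> n _ B mB; rewrite setTI.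
  rewrite (_ : _ @^-1` _ = \bigcup_(k : int) ((f ^~ (q n k) @^-1` B) `*`
     [set y : R | k%:~R / n.+1%:R <= y < (k + 1)%:~R / n.+1%:R])).
    apply: countable_bigcupT_measurable; first exact: countableP.
    move=> k; apply: measurableX.
      rewrite -[X in measurable X]setTI; apply: continuous_measurable_fun => //.
      by apply: (cplane_comp cf); cont.
    rewrite (_ : mkset _ = [set` `[k%:~R / n.+1%:R, (k + 1)%:~R / n.+1%:R[ ]).
      exact: measurable_itv.
    by apply/seteqP; split => y /=; rewrite in_itv.
  apply/seteqP; split => [[x y] /= Bxy|[x y] /= [k _ [Bx /andP[y1 y2]]]].
    exists (Num.floor (y * n.+1%:R)) => //; split => //=.
    by rewrite ler_pdivrMr // ltr_pdivlMr // floor_itv.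
  rewrite /h /= (_ : Num.floor _ = k) //; apply: floor_def.
  by rewrite -ler_pdivrMr // y1 -ltr_pdivlMr.
- move=> [x y] _; rewrite /h /=.
  have cfx : continuous (f x) by apply: (cplane_comp cf); cont.
  apply: (@cvg_comp _ _ _ (fun n : nat => q n (Num.floor (y * n.+1%:R))) (f x)
    \oo (nbhs y) (nbhs (f x y))); last exact: cfx.
  apply/cvgrPdist_lt => e e0.
  near=> n.
  have n0 : (0 : R) < n.+1%:R by [].
  have /andP[h1 h2] := floor_itv (y * n.+1%:R).
  rewrite ger0_norm; last by rewrite subr_ge0 ler_pdivrMr.
  apply: (@lt_trans _ _ (n.+1%:R^-1)); last by near: n; exact: (near_infty_natSinv_lt (PosNum e0)).
  rewrite ltrBlDr -[X in X + _]mul1r -mulrDl ltr_pdivlMr //.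
  by move: h2; rewrite intrD addrC.
Unshelve. all: by end_near.
Qed.

Local Open Scope ereal_scope.

Lemma oint_le_integral (f : R -> R) (a b : R) (g : R -> \bar R) (A : set R) :
  continuous f -> (a < b)%R -> (forall x, 0 <= f x)%R -> (forall x, 0 <= g x) ->
  `[a, b]%classic `<=` A -> (forall x, (a <= x <= b)%R -> (f x)%:E <= g x) ->
  (oint a b f)%:E <= \int[lebesgue_measure]_(x in A) g x.
Proof.
move=> cf ab f0 g0 abA fg; rewrite -oint_integral //.
exact: ge0_le_integral_sub.
Qed.

Lemma boxint_le_integral (f : R -> R -> R -> R) (L : R) :
  cfield f -> (0 < L)%R -> (forall x y t, 0 <= f x y t)%R ->
  (boxint L f)%:E <= \int[lebesgue_measure]_(t in `[0%R, 1%R])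
     \int[lebesgue_measure \x lebesgue_measure]_y (f y.1 y.2 t)%:E.
Proof.
move=> cf L0 f0; have LL : (- L < L)%R by lra.
have cft t : cplane (fun x y => f x y t) by apply: (cfield_comp cf); cont.
have cfxt x t : continuous (fun y => f x y t) by apply: (cfield_comp cf); cont.
pose g t := oint (- L) L (fun x => oint (- L) L (fun y => f x y t)).
have c1 : continuous (fun z : R * R => oint (- L) L (fun y => f z.1 y z.2)).
  apply: (@cont_oint R (R * R)%type (fun z y => f z.1 y z.2) (fun=> - L)%R (fun=> L)); cont.
  by apply: (cfield_comp cf); cont.
have cg : continuous g.
  apply: (@cont_oint R R (fun t x => oint (- L) L (fun y => f x y t))
    (fun=> - L)%R (fun=> L)); cont.
  by apply: (cont_comp2 (f := fun x t => oint (- L) L (fun y => f x y t)) c1); cont.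
have -> : boxint L f = oint 0 1 g.
  rewrite /boxint /g -(oint_exchange (- L) L 0 1 c1); congr oint; apply/funext => x.
  by rewrite (oint_exchange (- L) L 0 1 (f := f x)) //; apply: (cfield_comp cf); cont.
have g0 x t : (0 <= oint (- L) L (fun y => f x y t))%R by apply: oint_ge0 => //; exact: ltW.
have cgx t : continuous (fun x => oint (- L) L (fun y => f x y t)).
  by apply: (cont_comp2 (f := fun x t => oint (- L) L (fun y => f x y t)) c1); cont.
apply: oint_le_integral => //.
- by move=> t; apply: oint_ge0 => //; exact: ltW.
- by move=> t; apply: integral_ge0 => y _; rewrite lee_fin.
move=> t _.
rewrite (@fubini_tonelli1 _ _ _ _ _ lebesgue_measure lebesgue_measure); last 2 first.
- by apply/measurable_EFinP; exact: (cplane_measurable (cft t)).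
- by move=> z; rewrite lee_fin.
apply: oint_le_integral => //.
- by move=> x; apply: integral_ge0 => y _; rewrite lee_fin.
- move=> x _; apply: oint_le_integral => //.
  by move=> y; rewrite lee_fin.
Qed.

End Measurability.

(** * From fields on row vectors to fields of three variables *)

Section Transfer.
Context {R : realType}.
Implicit Types (f : 'rV[R]_3 -> R) (x y t : R).

(** Precomposing with the projection of the line on [0,1] turns a function
continuous on the slab into one continuous everywhere. *)
Definition clamp t : R := Num.max 0 (Num.min 1 t).

Lemma clamp_bounds t : 0 <= clamp t <= 1.
Proof. by rewrite /clamp le_max lexx ge_max ler01 ge_min lexx. Qed.

Lemma clamp_id t : 0 <= t <= 1 -> clamp t = t.
Proof. by move=> /andP[t0 t1]; rewrite /clamp min_r // max_r. Qed.

Lemma cont_clamp : continuous clamp.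
Proof.
move=> t; apply: continuous_max; first exact: cst_continuous.
by apply: continuous_min; [exact: cst_continuous|exact: cvg_id].
Qed.

Definition slab_xyz x y t : 'rV[R]_3 := slab_point (x, y) t.

Definition on_slab f x y t : R := f (slab_xyz x y (clamp t)).

Lemma slab_xyz0 x y t : slab_xyz x y t 0 o0 = x.
Proof. by rewrite mxE. Qed.
Lemma slab_xyz1 x y t : slab_xyz x y t 0 o1 = y.
Proof. by rewrite mxE. Qed.
Lemma slab_xyz2 x y t : slab_xyz x y t 0 o2 = t.
Proof. by rewrite mxE. Qed.

Lemma ord_max_o2 : ord_max = o2. Proof. exact: val_inj. Qed.

Lemma slab_xyz_in_slab x y t : 0 <= t <= 1 -> slab (slab_xyz x y t).
Proof. by rewrite /slab /= ord_max_o2 slab_xyz2. Qed.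

Lemma slab_xyz_eta (v : 'rV[R]_3) : v = slab_xyz (v 0 o0) (v 0 o1) (v 0 o2).
Proof.
by apply/rowP; apply: ord3_ind; rewrite mxE.
Qed.

Lemma cont_slab_xyz : continuous (fun z : R * R * R => slab_xyz z.1.1 z.1.2 (clamp z.2)).
Proof.
have cc : continuous (fun z : R * R * R => clamp z.2).
  by apply: (cont_comp cont_clamp); cont.
have c0 : continuous (fun z : R * R * R => z.1.1) by cont.
have c1 : continuous (fun z : R * R * R => z.1.2) by cont.
move=> z; apply/cvg_ballP => e e0.
near=> w; split => // i j; rewrite (ord1 i); move: j; apply: ord3_ind.
- by rewrite slab_xyz0 slab_xyz0; near: w; have /cvg_ballP := c0 z; apply.
- by rewrite slab_xyz1 slab_xyz1; near: w; have /cvg_ballP := c1 z; apply.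
- by rewrite slab_xyz2 slab_xyz2; near: w; have /cvg_ballP := cc z; apply.
Unshelve. all: by end_near.
Qed.

Lemma cfield_on_slab f : {within @slab R, continuous f} -> cfield (on_slab f).
Proof.
move=> /subspace_continuousP cf z.
have sz : slab (slab_xyz z.1.1 z.1.2 (clamp z.2)) by exact/slab_xyz_in_slab/clamp_bounds.
apply: (@cvg_comp _ _ _ (fun z : R * R * R => slab_xyz z.1.1 z.1.2 (clamp z.2)) f
   (nbhs z) (within (@slab R) (nbhs (slab_xyz z.1.1 z.1.2 (clamp z.2))))); last exact: cf.
move=> A; rewrite /within /= => nA.
have : nbhs z [set w : R * R * R | slab (slab_xyz w.1.1 w.1.2 (clamp w.2)) ->
    A (slab_xyz w.1.1 w.1.2 (clamp w.2))] := @cont_slab_xyz z _ nA.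
apply: filterS => w Aw.
by apply: Aw; apply: slab_xyz_in_slab; exact: clamp_bounds.
Qed.

Lemma slab_xyz_shift0 x y t h : h *: delta_mx 0 o0 + slab_xyz x y t = slab_xyz (h + x) y t.
Proof. by apply/rowP; apply: ord3_ind; rewrite !mxE /= ?mulr1 ?mulr0 ?add0r. Qed.
Lemma slab_xyz_shift1 x y t h : h *: delta_mx 0 o1 + slab_xyz x y t = slab_xyz x (h + y) t.
Proof. by apply/rowP; apply: ord3_ind; rewrite !mxE /= ?mulr1 ?mulr0 ?add0r. Qed.
Lemma slab_xyz_shift2 x y t h : h *: delta_mx 0 o2 + slab_xyz x y t = slab_xyz x y (h + t).
Proof. by apply/rowP; apply: ord3_ind; rewrite !mxE /= ?mulr1 ?mulr0 ?add0r. Qed.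

(** Horizontal translations preserve the slab, including its boundary planes. *)
Lemma increments_horizontal (j : 'I_3) x y t : j != o2 -> 0 <= t <= 1 ->
  increments j (slab_xyz x y t) = (0 : R)^'.
Proof.
move=> j2 t01.
have H (h : R) : slab (h *: delta_mx 0 j + slab_xyz x y t).
  elim/ord3_ind: j j2 => // _; [rewrite slab_xyz_shift0|rewrite slab_xyz_shift1];
    exact: slab_xyz_in_slab.
apply/seteqP; split => A; last exact: cvg_within.
by rewrite /increments /within /=; apply: filterS => h; apply; exact: H.
Qed.

Lemma is_derive_partial j f (v : 'rV[R]_3) (g : R -> R) (s : R) :
  has_partial j f v -> increments j v = (0 : R)^' ->
  (forall h, f (h *: delta_mx 0 j + v) = g (h + s)) -> f v = g s ->
  is_derive s 1 g (partial j f v).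
Proof.
move=> + e gh g0; rewrite /has_partial /partial e.
have -> : diff_quotient j f v =
    (fun h : R => h^-1 *: ((g \o shift s) (h *: (1 : R)) - g s)).
  by apply/funext => h; rewrite /diff_quotient gh g0 /= [h *: 1]mulr1.
by move=> c; apply: DeriveDef.
Qed.

Lemma pd_on_slab j f : smooth f -> pd j (on_slab f) (on_slab (partial j f)).
Proof.
move=> sf; have hp := (sf [::]).2.
elim/ord3_ind: j; rewrite /pd /= => x y t.
- have t01 := clamp_bounds t.
  have hp0 : has_partial o0 f (slab_xyz x y (clamp t)) := hp o0 _ (slab_xyz_in_slab x y t01).
  apply: (is_derive_partial hp0 (increments_horizontal (j := o0) x y isT t01)) => // h.
  by rewrite slab_xyz_shift0.
- have t01 := clamp_bounds t.
  have hp1 : has_partial o1 f (slab_xyz x y (clamp t)) := hp o1 _ (slab_xyz_in_slab x y t01).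
  apply: (is_derive_partial hp1 (increments_horizontal (j := o1) x y isT t01)) => // h.
  by rewrite slab_xyz_shift1.
- move=> t01; have /andP[t0 t1] := t01.
  have t01' : 0 <= t <= 1 by rewrite !ltW.
  have i01 : 0 < slab_xyz x y t 0 ord_max < 1 by rewrite ord_max_o2 slab_xyz2.
  have d : is_derive t 1 (fun t => f (slab_xyz x y t)) (partial o2 f (slab_xyz x y t)).
    have hp2 : has_partial o2 f (slab_xyz x y t) := hp o2 _ (slab_xyz_in_slab x y t01').
    apply: (is_derive_partial hp2 (increments_interior o2 i01)) => // h.
    by rewrite slab_xyz_shift2.
  rewrite {2}/on_slab (clamp_id t01'); apply: near_eq_is_derive d; near=> s.
  rewrite /on_slab clamp_id //; apply/andP; split; apply: ltW; near: s.
    exact: lt_nbhsr.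
  exact: lt_nbhsl.
Unshelve. all: by end_near.
Qed.

Lemma norm_component_le (a : 'rV[R]_3) i : `|a 0 i| <= `|a|.
Proof.
rewrite [leRHS]mx_normrE.
exact: (@le_bigmax _ R _ 0 (fun ij : 'I_1 * 'I_3 => `|a ij.1 ij.2|) (0, i)).
Qed.

Lemma smooth_partial j f : smooth f -> smooth (partial j f).
Proof.
by move=> sf s; have := sf (rcons s j); rewrite /partials foldr_rcons.
Qed.

Lemma smooth_continuous f : smooth f -> {within @slab R, continuous f}.
Proof. by move=> sf; have [] := sf [::]. Qed.

End Transfer.

Theorem theorem1p1 (R : realType) (u : 'rV[R]_3 -> 'rV[R]_3) (p : 'rV[R]_3 -> R)
    (u_smooth : smooth_field u)
    (u_bounded : [bounded u x | x in @slab R])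
    (p_smooth : smooth p)
    (momentum : forall x : 'rV[R]_3, slab x ->
       convection u x + gradient p x - laplacian u x = 0)
    (incompressible : forall x : 'rV[R]_3, slab x -> divergence u x = 0)
    (no_slip0 : forall x : 'rV[R]_3, x 0 ord_max = 0 -> u x = 0)
    (no_slip1 : forall x : 'rV[R]_3, x 0 ord_max = 1 -> u x = 0)
    (finite_dirichlet : (dirichlet_integral u < +oo)%E) :
  forall x : 'rV[R]_3, slab x -> u x = 0.
Proof.
pose v i := on_slab (component u i).
pose dv j i := on_slab (partial j (component u i)).
pose ddv j i := on_slab (partial j (partial j (component u i))).
have s1 j i : smooth (partial j (component u i)) by apply: smooth_partial; exact: u_smooth.
have fl : flow v dv ddv (on_slab p) (fun j => on_slab (partial j p)).
  split.
  - by move=> i; apply/cfield_on_slab/smooth_continuous/u_smooth.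
  - by move=> j i; apply/cfield_on_slab/smooth_continuous/s1.
  - by move=> j i; apply/cfield_on_slab/smooth_continuous/smooth_partial/s1.
  - exact/cfield_on_slab/smooth_continuous.
  - by move=> j; apply/cfield_on_slab/smooth_continuous/smooth_partial.
  - by move=> j i; apply: pd_on_slab; exact: u_smooth.
  - by move=> j i; apply: pd_on_slab; exact: s1.
  - by move=> j; apply: pd_on_slab.
  - move=> i x y t _; have := momentum _ (slab_xyz_in_slab x y (clamp_bounds t)).
    by move=> /rowP/(_ i); rewrite !mxE.
  - move=> x y t _; exact: incompressible (slab_xyz_in_slab x y (clamp_bounds t)).
  - move=> i x y; rewrite /v /on_slab /component !clamp_id ?lexx ?ler01 //.
    by rewrite no_slip0 ?no_slip1 ?mxE // ord_max_o2 slab_xyz2.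
have [M uM] : exists M : R, forall i (x y t : R), 0 <= t <= 1 -> `|v i x y t| <= M.
  have [M [_ HM]] := u_bounded; exists (M + 1) => i x y t _.
  have MM : M < M + 1 by rewrite ltrDl.
  apply: le_trans (HM (M + 1) MM _ (slab_xyz_in_slab x y (clamp_bounds t))).
  exact: norm_component_le.
have ED L : 0 <= L -> boxint L (energy dv) <= fine (dirichlet_integral u).
  move=> L0.
  have ce := cfield_energy fl.
  have e0 := energy_ge0 (du := dv).
  apply: (@le_trans _ _ (boxint (L + 1) (energy dv))).
    by apply: boxint_mono => //; rewrite lerDl.
  have L1 : 0 < L + 1 by rewrite ltr_wpDl.
  have := boxint_le_integral ce L1 e0.
  have -> : (\int[lebesgue_measure]_(t in `[0%R, 1%R])
     \int[lebesgue_measure \x lebesgue_measure]_y (energy dv y.1 y.2 t)%:E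
       = dirichlet_integral u)%E.
    apply: eq_integral => t; rewrite inE /= in_itv /= => t01.
    apply: eq_integral => y _; congr EFin.
    by rewrite /energy /dv /on_slab clamp_id.
  move=> le; rewrite -lee_fin fineK // fin_numE; apply/andP; split; last by rewrite lt_eqF.
  by rewrite gt_eqF // (lt_le_trans _ le) // ltNyr.
move=> x sx; have t01 : 0 <= x 0 o2 <= 1 by move: sx; rewrite /slab /= ord_max_o2.
apply/rowP => i; rewrite [in LHS](slab_xyz_eta x) mxE.
have := flow_eq0 fl uM ED i (x 0 o0) (x 0 o1) t01.
by rewrite /v /on_slab /component clamp_id.
Qed.
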